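(* Let $D\ge3$ be a prime. Consider a three-colorable $\{p,3\}$-lattice on a closed orientable surface of genus $\mathfrak{g}\geq 1$, where $p=6$ if $\mathfrak{g}=1$ and $p\ge8$ is even if $\mathfrak{g}\ge2$, whose vertices are labeled by two types, ''circle'' and ''square'', such that every edge joins a circle vertex and a square vertex. For each edge $(v,u)$ with $v$ a circle vertex and $u$ a square vertex, let the check $M_{(v,u)}$ be $$[X^{-2}]_v[X^{-2}]_u \text{ if the edge is green},\qquad [XZ]_v[XZ^{-1}]_u \text{ if it is red},\qquad [XZ^{-1}]_v[XZ]_u \text{ if it is blue}.$$ Then the qudit Floquet code defined by these checks encodes $2\mathfrak{g}$ logical qudits: there is a finite $T$ such that for all rounds $t\ge T$ the instantaneous stabilizer group $\mathcal{S}_t$ satisfies $\dim\mathcal{C}(\mathcal{S}_t)=D^{2\mathfrak{g}}$. Moreover, for all $t\ge T$, $\mathcal{S}_t$ is generated, up to multiplying generators by powers of $\omega$, by the checks measured in round $t$ together with one plaquette stabilizer for each face, which acts on the circle vertices and on the square vertices of the face, respectively, by $X^2$ and $X^2$ (green face), $X^{-1}Z^{-1}$ and $X^{-1}Z$ (red face), $X^{-1}Z$ and $X^{-1}Z^{-1}$ (blue face), and trivially elsewhere.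
   Context: Paulis: $\omega=e^{2\pi i/D}$, $[D]=\{0,\dots,D-1\}$; $X=\sum_j|j+1\bmod D\rangle\langle j|$, $Z=\sum_j\omega^j|j\rangle\langle j|$ on $\mathbb{C}^D$; $\mathcal{P}_D=\{\omega^lX^aZ^b:a,b,l\in[D]\}$. For $P\in\mathcal{P}_D$ and a vertex $v$, $[P]_v$ denotes the $n$-qudit operator acting as $P$ on qudit $v$ and as the identity on all other qudits. Lattice: one qudit of dimension $D$ sits on each of the $n$ vertices. A $\{p,3\}$-lattice on a closed orientable surface is a tessellation (cellular embedding of a connected simple graph $(V,E)$) in which every face (''plaquette'') has $p$ edges and every vertex has degree $3$. Three-colorable means that the faces can be colored green, red, blue so that faces sharing an edge have different colors; fix such a coloring. An edge gets the color of the two faces it connects (those at its two endpoints and not containing the edge in their boundary); thus each vertex meets exactly one edge of each color. Stabilizer groups and update: a stabilizer group $\mathcal{S}$ is an abelian subgroup of $\mathcal{P}_D^{\otimes n}$ without nontrivial scalars; $\mathcal{C}(\mathcal{S})$ is its common $+1$ eigenspace. Measuring an $n$-qudit Pauli $P$ with outcome $o\in[D]$ means projecting onto the $\omega^o$-eigenspace of $P$; it updates $\mathcal{S}$ to the group generated by $\omega^{-o}P$ and all elements of $\mathcal{S}$ commuting with $P$ ($o$ being an outcome of nonzero probability on $\mathcal{C}(\mathcal{S})$). Floquet code: start with $\mathcal{S}_{-1}=\{I^{\otimes n}\}$. In round $t\ge0$ measure all green, red, or blue checks according to $t\equiv0,1,2\pmod3$ respectively; the instantaneous stabilizer group $\mathcal{S}_t$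 is obtained from $\mathcal{S}_{t-1}$ by applying the update for each measurement, for any outcomes of nonzero probability. *)

(* Defs.v *)
From HB Require Import structures.
From mathcomp Require Import all_boot all_order all_algebra.
From mathcomp Require Import complex.
From mathcomp Require Import classical_sets reals trigo.
Set Implicit Arguments.
Unset Strict Implicit.
Unset Printing Implicit Defensive.
Import Order.TTheory GRing.Theory Num.Theory.
Local Open Scope ring_scope.

(* A cellular embedding of a finite connected simple graph in a closed
   orientable surface, encoded by its rotation system: [rotation v] lists the
   neighbours of [v] in the cyclic order induced by the orientation
   (Heffter-Edmonds). *)
Record embedded_graph (V : finType) := EmbeddedGraph {
  adj : rel V;
  adj_sym : symmetric adj;
  adj_irr : irreflexive adj;
  adj_nonempty : (0 < #|V|)%N;
  adj_connected : forall u v, connect adj u v;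
  rotation : V -> seq V;
  rotation_uniq : forall v, uniq (rotation v);
  mem_rotation : forall v u, (u \in rotation v) = adj v u }.

Variant color := Green | Red | Blue.

Definition color_eqb (c c' : color) : bool :=
  match c, c' with
  | Green, Green | Red, Red | Blue, Blue => true
  | _, _ => false
  end.
Lemma color_eqP : Equality.axiom color_eqb.
Proof. by do 2 case; constructor. Qed.
HB.instance Definition _ := hasDecEq.Build color color_eqP.

Section Lattice.
Variables (V : finType) (L : embedded_graph V).

(* The dart (v, u) is the edge {v, u} oriented from v to u. *)
Definition darts : {set V * V} := [set d | adj L d.1 d.2].
Definition rev_dart (d : V * V) : V * V := (d.2, d.1).

Definition edges : {set {set V}} := [set [set d.1; d.2] | d in darts].

(* The boundary walk of a face traverses d = (v, u) and then leaves u along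
   the edge that follows {u, v} in the rotation at u.  A face is identified
   with the set of darts of its boundary walk. *)
Definition face_next (d : V * V) : V * V := (d.2, next (rotation L d.2) d.1).
Definition face (d : V * V) : {set V * V} := [set d' | fconnect face_next d d'].
Definition faces : {set {set V * V}} := [set face d | d in darts].

Definition face_vertices (f : {set V * V}) : {set V} := [set d.1 | d in f].
Definition on_boundary (d : V * V) (f : {set V * V}) : bool :=
  (d \in f) || (rev_dart d \in f).

(* #|f| is the length of the boundary walk of f; it is the number of edges of
   f as soon as no edge has f on both sides, which any face coloring below
   guarantees. *)
Definition is_lattice (p q : nat) : Prop :=
  (forall f, f \in faces -> #|f| = p) /\ (forall v, #|[set u | adj L v u]| = q).

Definition has_genus (g : nat) : Prop :=
  #|V|%:Z - #|edges|%:Z + #|faces|%:Z = 2 - 2 * g%:Z.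

(* The two sides of every edge lie in faces of different colors. *)
Definition face_coloring (col : {set V * V} -> color) : Prop :=
  forall d, d \in darts -> col (face d) != col (face (rev_dart d)).

(* The edge {d.1, d.2} has color c if the faces at its endpoints that do not
   contain it in their boundary have color c. *)
Definition edge_has_color (col : {set V * V} -> color) (d : V * V) (c : color)
    : bool :=
  [forall f in faces,
    ((d.1 \in face_vertices f) || (d.2 \in face_vertices f))
      && ~~ on_boundary d f ==> (col f == c)].

Definition bipartition (circle : {set V}) : Prop :=
  forall v u, adj L v u -> (v \in circle) != (u \in circle).

(* The edges of color c, as pairs (circle vertex, square vertex). *)
Definition color_edges (col : {set V * V} -> color) (circle : {set V})
    (c : color) : {set V * V} :=
  [set d in darts | (d.1 \in circle) && edge_has_color col d c].

End Lattice.

Section Stabilizer.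
Variable C : numClosedFieldType.
Variable N : nat.
Implicit Types (P Q : 'M[C]_N) (S : set 'M[C]_N).

(* invmx is the identity on singular matrices; every generator used below is
   invertible, so that [generated] is the generated subgroup of GL_N(C). *)
Definition is_group S : Prop :=
  [/\ S 1%:M, forall P Q, S P -> S Q -> S (P *m Q)
    & forall P, S P -> S (invmx P)].

Definition generated (G : set 'M[C]_N) : set 'M[C]_N := smallest is_group G.

Definition code_space S : set 'cV[C]_N :=
  [set x | forall P, S P -> P *m x = x].

Definition has_dim (W : set 'cV[C]_N) (k : nat) : Prop :=
  exists U : {vspace 'cV[C]_N}, (forall x, x \in U <-> W x) /\ \dim U = k.

(* Q is the orthogonal projector onto the a-eigenspace of P. *)
Definition eigenprojector P (a : C) Q : Prop :=
  [/\ Q *m Q = Q, (map_mx Num.conj Q)^T = Q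
    & forall x : 'cV[C]_N, Q *m x = x <-> P *m x = a *: x].

(* Some state x of the code space has a nonzero Born probability
   |Q x|^2 / |x|^2 of giving the eigenvalue a when P is measured. *)
Definition possible_outcome S P (a : C) : Prop :=
  exists Q, eigenprojector P a Q /\ exists2 x, code_space S x & Q *m x != 0.

Definition update S P (a : C) : set 'M[C]_N :=
  generated ([set a^-1 *: P] `|` [set A | S A /\ A *m P = P *m A])%classic.

Fixpoint measure_seq (D : nat) (w : C) (s : seq 'M[C]_N) S S' : Prop :=
  if s is P :: s' then
    exists o : 'I_D, possible_outcome S P (w ^+ o) /\
                     measure_seq D w s' (update S P (w ^+ o)) S'
  else S' = S.

End Stabilizer.

Section Pauli.
Variables (R : realType) (D : nat).

Definition omega : R[i] :=
  Complex (cos (2 * pi / D%:R)) (sin (2 * pi / D%:R)).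

Definition pauliX : 'M[R[i]]_D :=
  \matrix_(i < D, j < D) (nat_of_ord i == j.+1 %% D)%N%:R.
Definition pauliZ : 'M[R[i]]_D :=
  \matrix_(i < D, j < D) (omega ^+ j *+ (i == j)).

(* (on circle vertices, on square vertices) *)
Definition check_paulis (c : color) : 'M[R[i]]_D * 'M[R[i]]_D :=
  match c with
  | Green => (invmx (pauliX *m pauliX), invmx (pauliX *m pauliX))
  | Red => (pauliX *m pauliZ, pauliX *m invmx pauliZ)
  | Blue => (pauliX *m invmx pauliZ, pauliX *m pauliZ)
  end.

Definition plaquette_paulis (c : color) : 'M[R[i]]_D * 'M[R[i]]_D :=
  match c with
  | Green => (pauliX *m pauliX, pauliX *m pauliX)
  | Red => (invmx pauliX *m invmx pauliZ, invmx pauliX *m pauliZ)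
  | Blue => (invmx pauliX *m pauliZ, invmx pauliX *m invmx pauliZ)
  end.

Variables (V : finType) (L : embedded_graph V).
Variables (col : {set V * V} -> color) (circle : {set V}).

(* The computational basis of the n qudits is indexed by the maps from V to
   [D]; its elements are numbered by enum_val. *)
Definition hdim : nat := #|{ffun V -> 'I_D}|.

Definition tensor (A : V -> 'M[R[i]]_D) : 'M[R[i]]_hdim :=
  \matrix_(i < hdim, j < hdim)
    \prod_(v : V) A v ((enum_val i : {ffun V -> 'I_D}) v)
                      ((enum_val j : {ffun V -> 'I_D}) v).

Definition at_vertex (P : 'M[R[i]]_D) (v : V) : 'M[R[i]]_hdim :=
  tensor (fun w => if w == v then P else 1%:M).

(* The check M_(v, u) of an edge d = (v, u) of color c, v a circle vertex. *)
Definition check (c : color) (d : V * V) : 'M[R[i]]_hdim :=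
  at_vertex (check_paulis c).1 d.1 *m at_vertex (check_paulis c).2 d.2.

Definition plaquette (f : {set V * V}) : 'M[R[i]]_hdim :=
  tensor (fun w =>
    if w \in face_vertices f then
      if w \in circle then (plaquette_paulis (col f)).1
      else (plaquette_paulis (col f)).2
    else 1%:M).

Definition round_color (t : nat) : color :=
  match (t %% 3)%N with 0%N => Green | 1%N => Red | _ => Blue end.

(* All checks of color c are measured, one after the other in some order. *)
Definition floquet_round (c : color) (S S' : set 'M[R[i]]_hdim) : Prop :=
  exists2 s : seq (V * V), perm_eq s (enum (color_edges L col circle c))
    & measure_seq D omega [seq check c d | d <- s] S S'.

(* [S t] is the instantaneous stabilizer group after round t >= 0. *)
Definition floquet_run (S : nat -> set 'M[R[i]]_hdim) : Prop :=
  floquet_round (round_color 0) [set 1%:M]%classic (S 0%N) /\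
  forall t, floquet_round (round_color t.+1) (S t) (S t.+1).

(* The checks measured in round t and the plaquette stabilizers, multiplied by
   the powers of omega with exponents a and b. *)
Definition round_generators (t : nat) (a : V * V -> 'I_D)
    (b : {set V * V} -> 'I_D) : set 'M[R[i]]_hdim :=
  ([set omega ^+ a d *: check (round_color t) d
      | d in [set` color_edges L col circle (round_color t)]] `|`
   [set omega ^+ b f *: plaquette f | f in [set` faces L]])%classic.

End Pauli.

(* Main.v *)
Require Import Defs.
From mathcomp Require Import all_boot all_order all_algebra.
From mathcomp Require Import complex ring zify.
From mathcomp Require Import classical_sets reals trigo.
Set Implicit Arguments.
Unset Strict Implicit.
Unset Printing Implicit Defensive.
Import Order.TTheory GRing.Theory Num.Theory.
Local Open Scope ring_scope.

(* In coordinates an n-qudit Pauli operator is, up to a phase, a vector of the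
   symplectic space (F_D x F_D)^V, and a stabilizer group with nonzero code
   space is an isotropic subgroup K of pairs (vector, phase) that projects
   injectively to vectors.  Measuring all checks of one color replaces the
   vectors of K by the span of these checks and of the vectors of K orthogonal
   to them.  A product of checks of color c commutes with all checks of another
   color c' exactly when its exponents are constant along the boundaries of the
   faces of the third color; since the three local Paulis at a vertex sum to 0,
   such a product is, modulo the new checks, a product of plaquettes of the
   third color.  So each of the rounds 1, 2, 3 adds the plaquettes of one color,
   and nothing changes afterwards.  The checks and plaquettes satisfy exactly
   two independent relations, hence |K| D^2 = D^(#checks + #faces); the code
   space has dimension D^n / |K|, which Euler's formula evaluates. *)

(** * Tensor products of one-qudit operators *)

Section Tensor.
Variables (R : realType) (D : nat) (V : finType).
Implicit Types A B : V -> 'M[R[i]]_D.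

Lemma tensor_mul A B :
  tensor A *m tensor B = tensor (fun v => A v *m B v).
Proof.
apply/matrixP=> i j; rewrite !mxE.
under [RHS]eq_bigr do rewrite mxE.
rewrite bigA_distr_bigA /= (reindex (@enum_rank {ffun V -> 'I_D})) /=; last first.
  by exists enum_val => k _; rewrite ?enum_rankK ?enum_valK.
by apply: eq_bigr => f _; rewrite !mxE enum_rankK big_split.
Qed.

Lemma tensor1 : tensor (fun=> 1%:M) = 1%:M :> 'M[R[i]]_(hdim D V).
Proof.
apply/matrixP=> i j; rewrite !mxE.
under eq_bigr do rewrite mxE.
have [->|nij] := eqVneq i j; first by rewrite big1 // => v _; rewrite eqxx.
case: (boolP [forall v, (enum_val i : {ffun V -> 'I_D}) v == enum_val j v]).
  move=> /forallP h.
  by case/eqP: nij; apply: enum_val_inj; apply/ffunP=> v; apply/eqP.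
by rewrite negb_forall => /existsP[v hv]; rewrite (bigD1 v) //= (negPf hv) mul0r.
Qed.

Lemma tensor_scale (c : V -> R[i]) A :
  tensor (fun v => c v *: A v) = (\prod_v c v) *: tensor A.
Proof.
apply/matrixP=> i j; rewrite !mxE -big_split /=.
by apply: eq_bigr => v _; rewrite mxE.
Qed.

Lemma eq_tensor A B : A =1 B -> tensor A = tensor B.
Proof.
by move=> h; apply/matrixP=> i j; rewrite !mxE; apply: eq_bigr => v _; rewrite h.
Qed.

Lemma tensor_adjoint A :
  (map_mx Num.conj (tensor A))^T = tensor (fun v => (map_mx Num.conj (A v))^T).
Proof.
apply/matrixP=> i j; rewrite !mxE rmorph_prod /=.
by apply: eq_bigr => v _; rewrite !mxE.
Qed.

End Tensor.

(** * Roots of unity and one-qudit Weyl operators *)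

Section Weyl.
Variables (R : realType) (D : nat).
Hypotheses (D_prime : prime D) (D_ge3 : (3 <= D)%N).
Local Notation F := 'F_D.
Local Notation C := R[i].
Local Notation w := (omega R D).

Lemma omega_expE n :
  w ^+ n = Complex (cos ((2 * pi / D%:R) *+ n)) (sin ((2 * pi / D%:R) *+ n)).
Proof.
elim: n => [|n IHn]; first by rewrite expr0 !mulr0n cos0 sin0.
rewrite exprS {}IHn /omega !mulrS cosD sinD.
by apply/eqP; rewrite eq_complex /=; apply/andP; split; apply/eqP; ring.
Qed.

(** As D is prime, the order of [w] is 1 or D. It is not 1: for D at least 3 the angle 2 pi / D lies
    strictly between 0 and pi, where the sine is positive. *)
Lemma omega_prim : D.-primitive_root w.
Proof.
have D0 : (D%:R : R) != 0 by rewrite pnatr_eq0 -lt0n (leq_trans _ D_ge3).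
have wD : w ^+ D = 1.
  have -> : w ^+ D = Complex (cos (pi *+ 2 : R)) (sin (pi *+ 2 : R)).
    rewrite omega_expE (_ : (2 * pi / D%:R) *+ D = pi *+ 2 :> R) //.
    by rewrite -[LHS]mulr_natr divfK // mulr_natl.
  by rewrite cos2pi mulr2n sinD sinpi !mul0r mulr0 addr0.
have w1 : w != 1.
  rewrite eq_complex /= negb_and; apply/orP; right.
  rewrite gt_eqF // sin_gt0_pi //.
  have D_gt0 : (0 : R) < D%:R by rewrite ltr0n (leq_trans _ D_ge3).
  rewrite divr_gt0 ?mulr_gt0 ?pi_gt0 //= ltr_pdivrMr //.
  by rewrite mulrC ltr_pM2l ?pi_gt0 // ltr_nat.
have [m mP] := prim_order_exists (prime_gt0 D_prime) wD.
move=> /(primeP D_prime).2 /orP[] /eqP mE; last by move: mP; rewrite mE.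
by move: mP (prim_expr_order mP) w1; rewrite mE expr1 => _ ->; rewrite eqxx.
Qed.

Lemma card_FD : #|{: F}| = D.
Proof. by rewrite card_Fp. Qed.

(** Exponents are taken in the field F_D so that phases can be halved. *)
Definition echar (k : F) : C := w ^+ (k : nat).

Lemma natF_mod (n : nat) : ((n%:R : F) : nat) = (n %% D)%N.
Proof. by rewrite val_Fp_nat. Qed.

Lemma echar_nat (n : nat) : echar n%:R = w ^+ n.
Proof.
by rewrite /echar natF_mod; apply/eqP; rewrite (eq_prim_root_expr omega_prim) modn_mod.
Qed.

Lemma natF_val (k : F) : ((k : nat)%:R : F) = k.
Proof. exact: natr_Zp. Qed.

Lemma echarD j k : echar (j + k) = echar j * echar k.
Proof. by rewrite -(natF_val j) -(natF_val k) -natrD !echar_nat exprD. Qed.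

Lemma echar0 : echar 0 = 1.
Proof. by rewrite (echar_nat 0) expr0. Qed.

Lemma echarN k : echar (- k) * echar k = 1.
Proof. by rewrite -echarD addNr echar0. Qed.

Lemma echar_eq1 k : echar k = 1 -> k = 0.
Proof.
move=> /eqP; rewrite -(prim_order_dvd omega_prim) => Dk.
rewrite -(natF_val k); apply/eqP.
by rewrite -(dvdn_pcharf (pchar_Fp D_prime)).
Qed.

Lemma echar_neq0 k : echar k != 0.
Proof.
apply: contraTneq (oner_neq0 C) => k0.
by rewrite -(echarN k) k0 mulr0 eqxx.
Qed.

Lemma echarV k : echar (- k) = (echar k)^-1.
Proof. by apply: (mulIf (echar_neq0 k)); rewrite echarN mulVf ?echar_neq0. Qed.

Lemma echar_conj k : Num.conj (echar k) = echar (- k).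
Proof.
apply: (mulIf (echar_neq0 k)); rewrite echarN mulrC -normCK.
have : `|echar k| ^+ D == 1.
  by rewrite -normrX -exprM mulnC exprM (prim_expr_order omega_prim) expr1n normr1.
by rewrite pexpr_eq1 ?prime_gt0 // => /eqP ->; rewrite expr1n.
Qed.

Lemma prod_echar (I : finType) (k : I -> F) :
  \prod_i echar (k i) = echar (\sum_i k i).
Proof. by rewrite (big_morph echar echarD echar0). Qed.

Definition ordF (i : 'I_D) : F := (i : nat)%:R.

Lemma ordF_inj : injective ordF.
Proof.
move=> i j /(congr1 (fun x : F => (x : nat))).
by rewrite /ordF !natF_mod !modn_small // => /val_inj.
Qed.

Lemma ordF_bij : bijective ordF.
Proof. by apply: inj_card_bij ordF_inj _; rewrite card_FD card_ord. Qed.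

(* The phase of X^a Z^b is chosen so that every commutation phase is half the
   symplectic form; this needs 2 invertible. *)
Definition weyl1 (x : F * F) : 'M[C]_D :=
  \matrix_(i, j) (echar (x.2 * ordF j + x.1 * x.2 / 2) *+ (ordF i == ordF j + x.1)).

Definition symp1 (x y : F * F) : F := x.2 * y.1 - x.1 * y.2.

Lemma two_neq0 : (2 : F) != 0.
Proof.
rewrite -(dvdn_pcharf (pchar_Fp D_prime)).
by apply/negP => /(dvdn_leq (isT : (0 < 2)%N)); rewrite leqNgt D_ge3.
Qed.

(** Each column of a Weyl matrix has a single nonzero entry, so the sum over the middle index
    collapses and only phases remain to be compared. *)
Lemma weyl1_mul x y :
  weyl1 x *m weyl1 y = echar (symp1 x y / 2) *: weyl1 (x + y).
Proof.
apply/matrixP=> i k; rewrite !mxE.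
case: ordF_bij => g gK Kg.
have [j jE] : exists j, ordF j = ordF k + y.1 by exists (g (ordF k + y.1)).
rewrite (bigD1 j) //= big1 ?addr0 => [|j' nj]; last first.
  rewrite !mxE -jE (inj_eq ordF_inj) (negPf nj) mulr0n mulr0 //.
rewrite !mxE jE eqxx mulr1n mulrnAl [RHS]mulrnAr -!echarD.
have -> : ordF k + y.1 + x.1 = ordF k + (x.1 + y.1) by rewrite -addrA [y.1 + _]addrC.
congr (echar _ *+ _); rewrite /symp1 /=.
by have h2 := two_neq0; field.
Qed.

Lemma weyl1_0 : weyl1 0 = 1%:M.
Proof.
apply/matrixP=> i j; rewrite !mxE /= !mul0r addr0 echar0 addr0.
by rewrite (inj_eq ordF_inj).
Qed.

Lemma weyl1_adjoint x : (map_mx Num.conj (weyl1 x))^T = weyl1 (- x).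
Proof.
apply/matrixP=> i j; rewrite !mxE rmorphMn /= echar_conj.
rewrite (_ : (ordF i == ordF j - x.1) = (ordF j == ordF i + x.1)); last first.
  by rewrite -subr_eq eq_sym opprK; congr (_ == _); rewrite ?opprK.
have [->|] := eqVneq (ordF j) (ordF i + x.1); last by rewrite !mulr0n.
by congr (echar _ *+ _); have h2 := two_neq0; field.
Qed.

End Weyl.

(** * Code spaces, projective measurements and ranks of projectors *)

Section CodeSpace.
Variables (C : numClosedFieldType) (N : nat).
Implicit Types (P Q A : 'M[C]_N) (S G : set 'M[C]_N) (x y : 'cV[C]_N).
Local Notation adjoint A := (map_mx Num.conj A)^T.

Lemma fixing_is_group x : is_group [set A : 'M[C]_N | A *m x = x]%classic.
Proof.
split=> [|P Q /= hP hQ|P /= hP]; first by rewrite /= mul1mx.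
  by rewrite -mulmxA hQ hP.
(* [invmx] returns a singular matrix unchanged. *)
case: (boolP (P \in unitmx)) => uP; last by rewrite /invmx (negPf uP).
by rewrite -{1}hP mulKmx.
Qed.

Lemma code_space_generated G x :
  (forall A, G A -> A *m x = x) -> code_space (generated G) x.
Proof. by move=> Gx; apply: (smallest_sub (fixing_is_group x)) => A; apply: Gx. Qed.

Lemma eq_mulmx_col P Q : (forall x, P *m x = Q *m x) -> P = Q.
Proof.
by move=> h; apply/trmx_inj/row_matrixP => i; rewrite -!tr_col !colE h.
Qed.

(* A commutes with P, hence preserves its eigenspaces; being unitary it also
   preserves their orthogonal complements. *)
Lemma eigenprojector_comm P a Q A :
  eigenprojector P a Q -> adjoint A *m A = 1%:M -> A *m P = P *m A ->
  Q *m A = A *m Q.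
Proof.
move=> [QQ Qadj Qeig] uA AP.
have stable B : B *m P = P *m B -> Q *m (B *m Q) = B *m Q.
  move=> BP; apply: eq_mulmx_col => x; rewrite -!mulmxA; apply/Qeig.
  rewrite mulmxA -BP -mulmxA.
  have -> : P *m (Q *m x) = a *: (Q *m x) by apply/Qeig; rewrite mulmxA QQ.
  by rewrite -scalemxAr.
have uA' := mulmx1C uA.
have A'P : adjoint A *m P = P *m adjoint A.
  by rewrite -[LHS]mulmx1 -uA' mulmxA -(mulmxA _ P A) -AP !mulmxA uA mul1mx.
have := congr1 (fun B => adjoint B) (stable _ A'P).
rewrite !map_mxM !trmx_mul /= Qadj.
have -> : adjoint (adjoint A) = A.
  by apply/matrixP => i j; rewrite !mxE conjCK.
by rewrite -mulmxA stable // => <-.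
Qed.

(** The projected state [Q *m x] is the required vector: it is an a-eigenvector of P, and the
    elements of S that commute with P also commute with Q. *)
Lemma possible_outcome_update S P a :
  a != 0 -> (forall A, S A -> adjoint A *m A = 1%:M) ->
  possible_outcome S P a ->
  exists2 y, code_space (update S P a) y & y != 0.
Proof.
move=> a0 uS [Q [Qp [x Sx Qx0]]]; exists (Q *m x) => //.
have [QQ Qadj Qeig] := Qp.
apply: code_space_generated => A [-> | [SA AP]].
  rewrite -scalemxAl.
  have -> : P *m (Q *m x) = a *: (Q *m x) by apply/Qeig; rewrite mulmxA QQ.
  by rewrite scalerA mulVf // scale1r.
by rewrite mulmxA -(eigenprojector_comm Qp) ?uS // -mulmxA Sx.
Qed.

(** The full-rank factors of [P = col_base P *m row_base P] can be cancelled on both sides of the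
    idempotence equation. *)
Lemma idempotent_base P :
  P *m P = P -> row_base P *m col_base P = 1%:M.
Proof.
move=> PP; apply: (row_full_inj (col_base_full P)).
apply: (row_free_inj (row_base_free P)).
by rewrite /= mulmxA mulmx_base mulmx1 -mulmxA mulmx_base PP.
Qed.

Lemma idempotent_trace P : P *m P = P -> (\rank P)%:R = \tr P.
Proof.
move=> PP; rewrite -{2}(mulmx_base P) mxtrace_mulC idempotent_base //.
by rewrite mxtrace1.
Qed.

(** The fixed vectors of P form its image, which [col_base P] parametrizes injectively, with left
    inverse [row_base P]. *)
Lemma has_dim_idempotent P (W : set 'cV[C]_N) :
  P *m P = P -> (forall x, W x <-> P *m x = x) -> has_dim W (\rank P).
Proof.
move=> PP WP; pose f := linfun (mulmx (col_base P) : 'cV_(\rank P) -> 'cV_N).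
have fE (z : 'cV_(\rank P)) : f z = col_base P *m z by rewrite lfunE.
exists (limg f); split=> [x|].
  split=> [/memv_imgP[z _ ->]|/WP <-].
    apply/WP; rewrite fE -{1}(mulmx_base P) -mulmxA (mulmxA (row_base P)).
    by rewrite idempotent_base // mul1mx.
  have -> : P *m x = f (row_base P *m x) by rewrite fE mulmxA mulmx_base.
  by rewrite memv_img ?memvf.
rewrite limg_dim_eq ?dimvf /dim /= ?muln1 //.
apply/eqP; rewrite -subv0; apply/subvP=> z.
rewrite memv_cap memv_ker fE => /andP[_ /eqP h].
by rewrite memv0 -(mul1mx z) -(idempotent_base PP) -mulmxA h mulmx0.
Qed.

End CodeSpace.

(** * The symplectic form and n-qudit Weyl operators *)

Section Stabilizers.
Variables (R : realType) (D : nat) (V : finType).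
Hypotheses (D_prime : prime D) (D_ge3 : (3 <= D)%N).
Local Notation F := 'F_D.
Local Notation C := R[i].
Local Notation W := {ffun V -> 'F_D * 'F_D}.
Local Notation e := (echar R).
Local Notation adjoint A := (map_mx Num.conj A)^T.
Implicit Types (x y : W) (u v : W * F) (K H : {set W * F}).

Definition symp x y : F := \sum_(q : V) symp1 (x q) (y q).

Lemma sympDl x x' y : symp (x + x') y = symp x y + symp x' y.
Proof.
rewrite /symp -big_split; apply: eq_bigr => v _.
by rewrite ffunE /symp1 /=; ring.
Qed.

Lemma sympC x y : symp x y = - symp y x.
Proof. by rewrite /symp -sumrN; apply: eq_bigr => v _; rewrite /symp1; ring. Qed.

Lemma sympDr x y y' : symp x (y + y') = symp x y + symp x y'.
Proof. by rewrite sympC sympDl opprD -!sympC. Qed.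

Lemma sympxx x : symp x x = 0.
Proof. by rewrite /symp big1 // => v _; rewrite /symp1 mulrC subrr. Qed.

Lemma symp0l y : symp 0 y = 0.
Proof. by apply: (addrI (symp 0 y)); rewrite -sympDl !addr0. Qed.

Lemma sympNl x y : symp (- x) y = - symp x y.
Proof. by apply: (addrI (symp x y)); rewrite -sympDl !subrr symp0l. Qed.

Lemma sympNr x y : symp x (- y) = - symp x y.
Proof. by rewrite sympC sympNl opprK sympC. Qed.

Lemma sympMzl x y (m : int) : symp (x *~ m) y = symp x y *~ m.
Proof.
have h (n : nat) : symp (x *+ n) y = symp x y *+ n.
  by elim: n => [|n IHn]; rewrite ?mulr0n ?symp0l // !mulrS sympDl IHn.
by case: m => n; [exact: h | rewrite !NegzE !mulrNz sympNl h].
Qed.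

(** A test vector supported on one vertex where x is nonzero reads off a nonzero coordinate of x
    there. *)
Lemma symp_nondeg x : x != 0 -> exists y, symp x y != 0.
Proof.
move=> x0; have [v xv0] : exists q : V, x q != 0.
  apply/existsP; apply: contraNT x0 => /existsPn h.
  by apply/eqP/ffunP => v; rewrite ffunE; apply/eqP; move: (h v); rewrite negbK.
pose d (z : F * F) : W := [ffun v' => if v' == v then z else 0].
have dE z : symp x (d z) = symp1 (x v) z.
  rewrite /symp (bigD1 v) //= big1 ?addr0 => [|v' nv]; rewrite ffunE ?eqxx //.
  by rewrite (negPf nv) /symp1 !mulr0 subrr.
have [x10|x1] := eqVneq (x v).1 0; last first.
  by exists (d (0, -1)); rewrite dE /symp1 /= mulr0 mulrN1 add0r opprK.
exists (d (1, 0)); rewrite dE /symp1 /= mulr0 subr0 mulr1.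
by apply: contra xv0 => /eqP x20; rewrite [x v]surjective_pairing x10 x20.
Qed.

(* The pair (x, k) stands for omega^k times the Weyl operator of x, so that
   isotropic subgroups K are stabilizer groups in coordinates. *)
Definition weyl u : 'M[C]_(hdim D V) :=
  e u.2 *: tensor (fun q => weyl1 R (u.1 q)).

Lemma weyl_mul u v : weyl u *m weyl v = e (symp u.1 v.1 / 2) *: weyl (u + v).
Proof.
rewrite /weyl -scalemxAl -scalemxAr scalerA tensor_mul.
rewrite (eq_tensor (fun q => weyl1_mul R D_prime D_ge3 (u.1 q) (v.1 q))).
rewrite tensor_scale (prod_echar R D_prime D_ge3) !scalerA -mulr_suml /=.
rewrite -!(echarD R D_prime D_ge3); congr (e _ *: _).
  by rewrite addrC.
by apply: eq_tensor => v'; rewrite ffunE.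
Qed.

Lemma weyl0 : weyl 0 = 1%:M.
Proof.
rewrite /weyl /= (echar0 R D_prime D_ge3) scale1r -[RHS]tensor1.
by apply: eq_tensor => v; rewrite ffunE weyl1_0.
Qed.

Lemma weyl_phase k : weyl (0, k) = (e k)%:M.
Proof.
rewrite -scalemx1 -weyl0 /weyl /= (echar0 R D_prime D_ge3) scale1r.
by congr (_ *: _).
Qed.

Lemma weylNr u : weyl u *m weyl (- u) = 1%:M.
Proof.
rewrite weyl_mul /= sympNr sympxx oppr0 mul0r (echar0 R D_prime D_ge3) scale1r.
by rewrite subrr weyl0.
Qed.

Lemma invmx_weyl u : invmx (weyl u) = weyl (- u).
Proof.
have [U _] := mulmx1_unit (weylNr u).
by rewrite -[RHS](mulKmx U) weylNr mulmx1.
Qed.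

Lemma weyl_adjoint u : adjoint (weyl u) = weyl (- u).
Proof.
rewrite /weyl map_mxZ /= linearZ /= (echar_conj R D_prime D_ge3) tensor_adjoint.
by congr (_ *: _); apply: eq_tensor => v; rewrite weyl1_adjoint // ffunE.
Qed.

Lemma weyl_unitary u : adjoint (weyl u) *m weyl u = 1%:M.
Proof. by rewrite weyl_adjoint -{2}[u]opprK weylNr. Qed.

Lemma weyl_comm u v : weyl u *m weyl v = e (symp u.1 v.1) *: (weyl v *m weyl u).
Proof.
rewrite !weyl_mul scalerA -(echarD R D_prime D_ge3) (addrC v) (sympC v.1).
by congr (e _ *: _); have h2 := two_neq0 D_prime D_ge3; field.
Qed.

Lemma hdimE : hdim D V = (D ^ #|V|)%N.
Proof. by rewrite /hdim card_ffun card_ord. Qed.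

Lemma hdim_gt0 : (0 < hdim D V)%N.
Proof. by rewrite hdimE expn_gt0 prime_gt0. Qed.

Lemma weyl_commP u v :
  weyl u *m weyl v = weyl v *m weyl u <-> symp u.1 v.1 = 0.
Proof.
split=> [h|h]; last by rewrite weyl_comm h (echar0 R D_prime D_ge3) scale1r.
apply: (echar_eq1 (R := R) D_prime D_ge3).
have := weyl_comm u v; rewrite h => /(congr1 (fun A => A *m (weyl (- u) *m weyl (- v)))).
rewrite -scalemxAl -mulmxA (mulmxA (weyl u)) weylNr mul1mx weylNr.
(* The identity has nonzero trace, so taking traces forces the phase to be 1. *)
move=> /(congr1 (fun A => \tr A)); rewrite mxtraceZ mxtrace1.
have N0 : ((hdim D V)%:R : C) != 0 by rewrite pnatr_eq0 -lt0n hdim_gt0.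
by move=> E; apply: (mulIf N0); rewrite -E mul1r.
Qed.

(** Conjugation by a Weyl operator not commuting with [weyl u] multiplies it by a phase other than 1
    but preserves its trace. *)
Lemma mxtrace_weyl u : u.1 != 0 -> \tr (weyl u) = 0.
Proof.
move=> /symp_nondeg[y uy].
have : \tr (weyl u) = e (symp u.1 y) * \tr (weyl u).
  have := congr1 (fun A => \tr (A *m weyl (- (y, 0)))) (weyl_comm u (y, 0)).
  rewrite /= -mulmxA weylNr mulmx1 -scalemxAl mxtraceZ => {1}->; congr (_ * _).
  by rewrite mxtrace_mulC mulmxA (mulmx1C (weylNr _)) mul1mx.
move=> /eqP; rewrite -{1}[\tr _]mul1r -subr_eq0 -mulrBl mulf_eq0 subr_eq0.
case/orP=> /eqP // /esym /(echar_eq1 D_prime D_ge3) uy0.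
by rewrite uy0 eqxx in uy.
Qed.

End Stabilizers.

(** * Stabilizer groups in coordinates and their updates *)

Section StabilizerGroups.
Variables (R : realType) (D : nat) (V : finType).
Hypotheses (D_prime : prime D) (D_ge3 : (3 <= D)%N).
Local Notation F := 'F_D.
Local Notation C := R[i].
Local Notation W := {ffun V -> 'F_D * 'F_D}.
Local Notation e := (echar R).
Local Notation weyl := (@weyl R D V).
Implicit Types (x y z : W) (u v : W * F) (K H G : {set W * F}).

Definition isotropic K := {in K &, forall u v, symp u.1 v.1 = 0}.

Definition weyl_set K : set 'M[C]_(hdim D V) :=
  [set weyl u | u in [set` K]]%classic.

Lemma mem_weyl_set K u : u \in K -> weyl_set K (weyl u).
Proof. by move=> uK; exists u. Qed.

Lemma zmod_closedMz (U : zmodType) (H : {pred U}) a (m : int) :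
  zmod_closed H -> a \in H -> a *~ m \in H.
Proof.
move=> Hz aH; have [H0 HB] := Hz; have HN := GRing.zmod_closedN Hz.
have HD := (GRing.zmod_closedD Hz).2.
have h (n : nat) : a *+ n \in H.
  by elim: n => [|n IHn]; rewrite ?mulr0n // mulrS HD.
by case: m => n; [exact: h | rewrite NegzE mulrNz HN // h].
Qed.

Lemma fst_mulrz (U U' : zmodType) (a : U * U') (m : int) : (a *~ m).1 = a.1 *~ m.
Proof.
have h (n : nat) : (a *+ n).1 = a.1 *+ n by elim: n => // n; rewrite !mulrS => <-.
by case: m => n; rewrite ?NegzE ?mulrNz /= h.
Qed.

(** On an isotropic subgroup the commutation phases vanish, so [weyl] is a homomorphism and
    generation of matrix groups reduces to generation of additive subgroups. *)
Lemma generated_weyl_set K G :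
  zmod_closed K -> isotropic K -> G \subset K ->
  (forall H, zmod_closed H -> G \subset H -> K \subset H) ->
  generated (weyl_set G) = weyl_set K.
Proof.
move=> [K0 KB] Kiso GK Kmin; apply/seteqP; split.
  apply: smallest_sub => [|_ [u /= uG <-]]; last first.
    by exists u => //=; apply: (fintype.subsetP GK).
  split=> [|_ _ [u uK <-] [v vK <-]|_ [u uK <-]].
  - by exists 0 => //; rewrite weyl0.
  - exists (u + v); last first.
      rewrite (weyl_mul R D_prime D_ge3) Kiso // mul0r.
      by rewrite (echar0 R D_prime D_ge3) scale1r.
    by rewrite /= -[v]opprK KB // -[- v]add0r KB.
  - by exists (- u); rewrite ?invmx_weyl //= -[- u]add0r KB.
move=> _ [u /= uK <-] M [[M1 MM MV] GM].
(* H is the preimage in K of an arbitrary group M containing the generators; minimality of K then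
   gives [K \subset H]. *)
pose H := [set v in K | boolp.asbool (M (weyl v))].
have HK v : v \in H -> v \in K /\ M (weyl v).
  by rewrite inE => /andP[vK /boolp.asboolP].
have /fintype.subsetP KH : K \subset H.
  apply: Kmin; last first.
    apply/fintype.subsetP => v vG; rewrite inE (fintype.subsetP GK) //=.
    by apply/boolp.asboolP/GM; exists v.
  split=> [|v v' /HK[vK Mv] /HK[v'K Mv']].
    by rewrite inE K0; apply/boolp.asboolP; rewrite weyl0.
  rewrite inE KB //=; apply/boolp.asboolP.
  have -> : weyl (v - v') = weyl v *m invmx (weyl v').
    rewrite invmx_weyl // (weyl_mul R D_prime D_ge3) /= sympNr Kiso //.
    by rewrite oppr0 mul0r (echar0 R D_prime D_ge3) scale1r.
  by apply: MM => //; apply: MV.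
by case: (HK _ (KH _ uK)).
Qed.

(** The nonzero code vector excludes nontrivial scalars, and outcomes of nonzero probability
    preserve its existence. *)
Definition stab (S : set 'M[C]_(hdim D V)) K : Prop :=
  [/\ zmod_closed K, isotropic K, S = weyl_set K
    & exists2 x, code_space S x & x != 0].

(** Forgetting the phases forgets the outcomes, so this set evolves deterministically under
    measurements. *)
Definition support_space K : set W := [set x | exists k, (x, k) \in K]%classic.

(** The pair stands for a scalar matrix, and this scalar fixes a nonzero vector. *)
Lemma stab_phase S K (k : F) : stab S K -> (0, k) \in K -> k = 0.
Proof.
move=> [_ _ -> [x Sx x0]] kK; apply: (echar_eq1 (R := R) D_prime D_ge3).
have /eqP := Sx _ (mem_weyl_set kK).
rewrite (weyl_phase R _ D_prime D_ge3) mul_scalar_mx -{2}[x]scale1r -subr_eq0.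
by rewrite -scalerBl scaler_eq0 (negPf x0) orbF subr_eq0 => /eqP.
Qed.

Lemma stab_inj S K : stab S K -> {in K &, injective fst}.
Proof.
move=> SK [x k] [y l] xK yK /= exy; rewrite exy in xK *.
have [[_ KB] _ _ _] := SK; congr (_, _); apply/eqP; rewrite -subr_eq0; apply/eqP.
by apply: (stab_phase SK); rewrite -[0](subrr y); apply: (KB _ _ xK yK).
Qed.

Lemma stab_start : stab [set 1%:M]%classic [set (0 : W * F)].
Proof.
split.
- by split=> [|u v]; rewrite !inE // => /eqP-> /eqP->; rewrite subr0.
- by move=> u v; rewrite !inE => /eqP-> /eqP->; rewrite symp0l.
- apply/seteqP; split=> [_ ->|_ [u /= + <-]].
    by exists 0; rewrite /= ?inE ?weyl0.
  by rewrite inE => /eqP->; rewrite weyl0.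
exists (const_mx 1); first by move=> _ ->; rewrite mul1mx.
apply/eqP=> /matrixP/(_ (Ordinal (hdim_gt0 V D_prime)) 0).
by rewrite !mxE => /eqP; rewrite oner_eq0.
Qed.

Lemma weyl_scale u k : e k *: weyl u = weyl (u.1, u.2 + k).
Proof. by rewrite /weyl scalerA /= (echarD R D_prime D_ge3) mulrC. Qed.

(** The powers of the rescaled measured operator times the old elements commuting with it already
    form an isotropic subgroup, so nothing else is generated. *)
Lemma stab_update S K u (o : 'I_D) :
  stab S K -> possible_outcome S (weyl u) (omega R D ^+ o) ->
  exists2 K', stab (update S (weyl u) (omega R D ^+ o)) K' &
    forall x, support_space K' x <-> exists (m : int) y,
      [/\ support_space K y, symp y u.1 = 0 & x = u.1 *~ m + y].
Proof.
move=> [Kz Kiso SE _] out.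
have [K0 KB] := Kz.
have KN := GRing.zmod_closedN Kz; have KD := (GRing.zmod_closedD Kz).2.
(* Dividing the measured operator by omega^o lowers its phase by o. *)
pose u' : W * F := (u.1, u.2 - (o : nat)%:R).
pose P v := exists (m : int) v0, [/\ v0 \in K, symp v0.1 u.1 = 0 & v = u' *~ m + v0].
pose K' := [set v | boolp.asbool (P v)].
have K'P v : v \in K' <-> P v by rewrite inE; split=> [/boolp.asboolP|/boolp.asboolP].
have K'z : zmod_closed K'.
  split; first by apply/K'P; exists 0, 0; rewrite symp0l mulr0z addr0.
  move=> _ _ /K'P[m [v0 [v0K s0 ->]]] /K'P[m' [v1 [v1K s1 ->]]]; apply/K'P.
  exists (m - m'), (v0 - v1); rewrite KB // sympDl sympNl s0 s1 subrr mulrzBr.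
  by split=> //; rewrite opprD addrACA.
have K'iso : isotropic K'.
  move=> _ _ /K'P[m [v0 [v0K s0 ->]]] /K'P[m' [v1 [v1K s1 ->]]].
  rewrite /= !fst_mulrz !sympDl !sympDr !(sympMzl, sympC _ (u.1 *~ _)).
  rewrite sympxx !(sympC u.1) s0 s1 Kiso //.
  by rewrite !(mul0rz, oppr0, addr0).
pose G := u' |: [set v in K | symp v.1 u.1 == 0].
have upd : update S (weyl u) (omega R D ^+ o) = weyl_set K'.
  rewrite -(@generated_weyl_set K' G) //.
  - congr generated; apply/seteqP; split.
      move=> A [->|]; last first.
        rewrite SE => -[[v vK <-] /(weyl_commP R D_prime D_ge3) vu].
        by exists v => //=; rewrite !inE vK vu eqxx orbT.
      exists u'; first by rewrite /= !inE eqxx.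
      rewrite -(echar_nat R D_prime D_ge3) -weyl_scale; congr (_ *: _).
      by rewrite echarV.
    move=> _ [v /= + <-]; rewrite !inE => /orP[/eqP->|/andP[vK /eqP vu]].
      left; rewrite -(echar_nat R D_prime D_ge3) /u' -weyl_scale; congr (_ *: _).
      by rewrite echarV.
    by right; rewrite SE; split; [exists v | apply/(weyl_commP R D_prime D_ge3)].
  - apply/fintype.subsetP => v vG; apply: (K'P v).2; move: vG.
    rewrite !inE => /orP[/eqP->|/andP[vK /eqP vu]].
      by exists 1, 0; rewrite K0 symp0l addr0.
    by exists 0, v; rewrite mulr0z add0r.
  move=> H Hz /fintype.subsetP GH; apply/fintype.subsetP => _ /K'P[m [v0 [v0K s0 ->]]].
  apply: (GRing.zmod_closedD Hz).2; last by apply: GH; rewrite !inE v0K s0 eqxx orbT.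
  by apply: zmod_closedMz => //; apply: GH; rewrite !inE eqxx.
exists K'; last first.
  move=> x; split=> [[k /K'P[m [v0 [v0K s0 E]]]]|[m [y [[k yK] s0 ->]]]].
    exists m, v0.1; split=> //; last by rewrite -[x]/(x, k).1 E /= fst_mulrz.
    by exists v0.2; rewrite -surjective_pairing.
  exists (u' *~ m + (y, k)).2; apply/K'P; exists m, (y, k); split=> //.
  by rewrite [RHS]surjective_pairing /= fst_mulrz.
split=> //.
apply: possible_outcome_update out; last first.
  by move=> A; rewrite SE => -[v _ <-]; apply: weyl_unitary.
by rewrite -(echar_nat R D_prime D_ge3) echar_neq0.
Qed.

(** Induction on s. The measured operators commute pairwise, so adding multiples of one leaves the
    symplectic products with the others unchanged. *)
Lemma stab_measure_seq (I : eqType) (s : seq I) (f : I -> W * F) S S' K :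
  uniq s -> {in s &, forall i j, symp (f i).1 (f j).1 = 0} ->
  stab S K -> measure_seq D (omega R D) [seq weyl (f i) | i <- s] S S' ->
  exists2 K', stab S' K' &
    forall x, support_space K' x <-> exists (m : I -> int) y,
      [/\ support_space K y, {in s, forall i, symp y (f i).1 = 0}
        & x = \sum_(i <- s) (f i).1 *~ m i + y].
Proof.
elim: s S K => [|i s IHs] S K /=.
  move=> _ _ SK ->; exists K => // x; split=> [xK|[m [y [yK _ ->]]]].
    by exists (fun=> 0), x; rewrite big_nil add0r.
  by rewrite big_nil add0r.
move=> /andP[iNs us] com SK [o [out rest]].
have [K1 SK1 K1E] := stab_update SK out.
have [|K' SK' K'E] := IHs _ _ us _ SK1 rest.
  by move=> j k js ks; apply: com; rewrite inE ?js ?ks orbT.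
exists K' => // x; rewrite K'E; split.
  move=> [m [y1 [/K1E[m0 [y [yK yi ->]]] y1s ->]]].
  (* As i does not occur in s, overriding its coefficient leaves the sum over s unchanged. *)
  exists (fun j => if j == i then m0 else m j), y; split=> // [j|].
    rewrite inE => /orP[/eqP->//|js]; move: (y1s j js).
    by rewrite sympDl sympMzl com ?inE ?eqxx ?js ?orbT // mul0rz add0r.
  rewrite big_cons eqxx addrA; congr (_ + _).
  rewrite addrC; congr (_ + _); apply: eq_big_seq => j js.
  by case: eqP js iNs => // -> ->.
move=> [m [y [yK ys ->]]]; exists m, ((f i).1 *~ m i + y); split.
- by apply/K1E; exists (m i), y; split=> //; apply: ys; rewrite inE eqxx.
- move=> j js; rewrite sympDl sympMzl com ?inE ?eqxx ?js ?orbT // mul0rz add0r.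
  by apply: ys; rewrite inE js orbT.
- by rewrite big_cons addrA [_ + \sum_(_ <- _) _]addrC.
Qed.

(** The average P of the group projects onto the code space. By injectivity on vectors only the
    identity contributes to its trace, which is D^n / |K|, and the rank of a projector is its
    trace. *)
Lemma stab_has_dim S K k :
  stab S K -> (#|K| * D ^ k)%N = (D ^ #|V|)%N -> has_dim (code_space S) (D ^ k)%N.
Proof.
move=> SK cardK; have [[K0 KB] Kiso SE _] := SK.
have KN u : u \in K -> - u \in K by move=> uK; rewrite -[- u]add0r KB.
have KD u v : u \in K -> v \in K -> u + v \in K.
  by move=> uK vK; rewrite -[v]opprK KB // KN.
have K_gt0 : (0 < #|K|)%N by apply/card_gt0P; exists 0.
have cK : (#|K|%:R : C) != 0 by rewrite pnatr_eq0 -lt0n.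
pose P := (#|K|%:R : C)^-1 *: \sum_(u in K) weyl u.
have KP u : u \in K -> weyl u *m P = P.
  move=> uK; rewrite /P -scalemxAr mulmx_sumr; congr (_ *: _).
  rewrite [RHS](reindex_inj (addrI u)) /=; apply: eq_big => v.
    apply/idP/idP => [vK|uvK]; first exact: KD.
    by rewrite -(addKr u v) KD // KN.
  move=> vK; rewrite (weyl_mul R D_prime D_ge3) Kiso // mul0r.
  by rewrite (echar0 R D_prime D_ge3) scale1r.
have PP : P *m P = P.
  rewrite {1}/P -scalemxAl mulmx_suml (eq_bigr (fun=> P)); last by move=> u /KP.
  by rewrite sumr_const -[X in _ *: X]scaler_nat scalerA mulVf // scale1r.
have trP : \tr P = (D ^ k)%:R.
  rewrite mxtraceZ raddf_sum /= (bigD1 (0 : W * F)) //= big1 ?addr0.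
    by rewrite weyl0 // mxtrace1 hdimE -cardK natrM mulrA mulVf // mul1r.
  move=> u /andP[uK u0]; apply: mxtrace_weyl => //; apply: contra u0 => /eqP u0.
  by apply/eqP; apply: (stab_inj SK).
have <- : \rank P = (D ^ k)%N.
  by apply/eqP; rewrite -(eqr_nat C) idempotent_trace // trP.
apply: has_dim_idempotent => // x; split=> [Sx|Px].
  rewrite /P -scalemxAl mulmx_suml (eq_bigr (fun=> x)).
    by rewrite sumr_const -[X in _ *: X]scaler_nat scalerA mulVf // scale1r.
  by move=> u uK; apply: Sx; rewrite SE; exists u.
by move=> A; rewrite SE => -[u uK <-]; rewrite -Px mulmxA KP.
Qed.

End StabilizerGroups.

(** * Cubic lattices with three-colored faces *)

Lemma next3 (T : eqType) (s : seq T) x :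
  uniq s -> size s = 3 -> x \in s ->
  [/\ next s (next s (next s x)) = x, next s x \in s &
    forall y, y \in s -> [\/ y = x, y = next s x | y = next s (next s x)]].
Proof.
case: s => [|a [|b [|c []]]] //= /and3P[+ + _] _.
rewrite !inE negb_or => /andP[ab ac] bc.
have [ba ca cb] : [/\ (b == a) = false, (c == a) = false & (c == b) = false].
  by split; apply/negbTE; rewrite eq_sym.
case/or3P => /eqP->; do ?rewrite !(eqxx, ba, ca, cb, negPf ab, negPf ac, negPf bc) /=.
- split=> [//||y]; first by rewrite ?inE ?eqxx ?orbT.
  by rewrite ?inE => /or3P[]/eqP->; [constructor 1|constructor 2|constructor 3].
- split=> [//||y]; first by rewrite ?inE ?eqxx ?orbT.
  by rewrite ?inE => /or3P[]/eqP->; [constructor 3|constructor 1|constructor 2].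
- split=> [//||y]; first by rewrite ?inE ?eqxx ?orbT.
  by rewrite ?inE => /or3P[]/eqP->; [constructor 2|constructor 3|constructor 1].
Qed.

Lemma color_cases (a b c x : color) :
  a != b -> b != c -> c != a -> [\/ x = a, x = b | x = c].
Proof.
by case: a b c x => [] [] [] [] //= _ _ _; [> (constructor 1; done) ||
  (constructor 2; done) || (constructor 3; done) ..].
Qed.

Lemma third_color (a b : color) : exists c, (a != c) && (b != c).
Proof.
by case: a b => [] []; first [by exists Green | by exists Red | by exists Blue].
Qed.

Section Combinatorics.
Variables (V : finType) (L : embedded_graph V).
Variables (col : {set V * V} -> color) (circle : {set V}).
Hypothesis L_cubic : forall v, #|[set u | adj L v u]| = 3.
Hypothesis col_faces : face_coloring L col.
Hypothesis L_bipartite : bipartition L circle.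
Implicit Types (c : color) (u v w : V) (d : V * V) (f : {set V * V}).
Local Notation turn v := (next (rotation L v)).
Local Notation face := (face L).

Lemma turnP v w : adj L v w ->
  [/\ turn v (turn v (turn v w)) = w, adj L v (turn v w) &
    forall u, adj L v u -> [\/ u = w, u = turn v w | u = turn v (turn v w)]].
Proof.
rewrite -mem_rotation => wv; have Us := rotation_uniq L v.
have s3 : size (rotation L v) = 3.
  rewrite -(L_cubic v) -(card_uniqP Us); apply: eq_card => u.
  by rewrite inE mem_rotation.
have [h1 h2 h3] := next3 Us s3 wv; split=> // [|u]; rewrite -mem_rotation //.
exact: h3.
Qed.

(** This makes [fconnect] symmetric, so that faces are equivalence classes of darts. *)
Lemma face_next_inj : injective (face_next L).
Proof.
move=> [a b] [a' b'] [/= <-{b'}] /(can_inj (prev_next (rotation_uniq L b))) <- //.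
Qed.

Lemma mem_face d : d \in face d.
Proof. by rewrite inE connect0. Qed.

Lemma face_eq d d' : d' \in face d -> face d' = face d.
Proof.
rewrite inE => dd'; apply/setP => x; rewrite !inE.
by rewrite (same_connect (fconnect_sym face_next_inj) dd').
Qed.

Lemma face_next_mem d : face_next L d \in face d.
Proof. by rewrite inE fconnect1. Qed.

(** The walk arriving along (w, v) leaves by (v, turn v w). Hence every face around v is the face of
    a dart leaving v. *)
Lemma face_rev v w : face (w, v) = face (v, turn v w).
Proof. by rewrite -(face_eq (face_next_mem (w, v))). Qed.

Lemma darts_next d : d \in darts L -> face_next L d \in darts L.
Proof.
rewrite !inE /= adj_sym => d2d1.
by have [_ ->] := turnP d2d1.
Qed.

Lemma darts_face d d' : d \in darts L -> d' \in face d -> d' \in darts L.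
Proof.
move=> dL; rewrite inE => /iter_findex <-.
by elim: findex => //= n; apply: darts_next.
Qed.

Lemma col_turn v w : adj L v w -> col (face (v, w)) != col (face (v, turn v w)).
Proof.
by move=> vw; rewrite -face_rev; apply: (col_faces (d := (v, w))); rewrite inE.
Qed.

(** Consecutive faces around v are separated by an edge, and there are three of them in cyclic
    order, so their colors are all distinct. *)
Lemma face_colors v w c : adj L v w ->
  [\/ c = col (face (v, w)), c = col (face (v, turn v w))
    | c = col (face (v, turn v (turn v w)))].
Proof.
move=> vw; have [w3 vw' _] := turnP vw; have [_ vw'' _] := turnP vw'.
apply: color_cases; rewrite ?col_turn //.
by have := col_turn vw''; rewrite w3.
Qed.

Lemma face_color_inj v u w :
  adj L v u -> adj L v w -> col (face (v, u)) = col (face (v, w)) -> u = w.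
Proof.
move=> vu vw; have [w3 vw' h] := turnP vw; have [_ vw'' _] := turnP vw'.
have n1 := col_turn vw; have n3 := col_turn vw''; rewrite w3 in n3.
case: (h u vu) => -> // E; first by rewrite E eqxx in n1.
by rewrite E eqxx in n3.
Qed.

(** On a three-colored cubic lattice exactly one dart leaving v qualifies, so the default v is never
    returned. *)
Definition face_dart c v : V :=
  odflt v [pick w | adj L v w && (col (face (v, w)) == c)].

Lemma face_dartP c v :
  adj L v (face_dart c v) /\ col (face (v, face_dart c v)) = c.
Proof.
rewrite /face_dart; case: pickP => [w /andP[vw /eqP //]|none].
have [w vw] : exists w, adj L v w.
  have /card_gt0P[w] : (0 < #|[set u | adj L v u]|)%N by rewrite L_cubic.
  by rewrite inE; exists w.
have [_ vw' _] := turnP vw; have [_ vw'' _] := turnP vw'.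
by case: (face_colors c vw) => E; [move: (none w)|move: (none (turn v w))|
  move: (none (turn v (turn v w)))]; rewrite ?vw ?vw' ?vw'' E eqxx.
Qed.

Lemma face_dart_uniq v w : adj L v w -> face_dart (col (face (v, w))) v = w.
Proof.
move=> vw; have [h E] := face_dartP (col (face (v, w))) v.
exact: face_color_inj h vw E.
Qed.

Definition face_at c v : {set V * V} := face (v, face_dart c v).

Lemma face_at_faces c v : face_at c v \in faces L.
Proof. by apply: imset_f; rewrite inE; case: (face_dartP c v). Qed.

Lemma col_face_at c v : col (face_at c v) = c.
Proof. by case: (face_dartP c v). Qed.

Lemma mem_face_at c v : v \in face_vertices (face_at c v).
Proof. by apply/imsetP; exists (v, face_dart c v); rewrite ?mem_face. Qed.

(** A face through v contains a dart leaving v, and its color determines that dart. *)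
Lemma face_at_uniq f v :
  f \in faces L -> v \in face_vertices f -> f = face_at (col f) v.
Proof.
move=> /imsetP[d0 d0L ->] /imsetP[d /[dup] /(darts_face d0L) dL /face_eq <- ->].
move: dL; rewrite inE; case: d => v' w /= vw.
by rewrite /face_at face_dart_uniq.
Qed.

Lemma face_at_vertices v f :
  f \in faces L -> (v \in face_vertices f) = (f == face_at (col f) v).
Proof.
move=> fL; apply/idP/eqP => [|->]; first exact: face_at_uniq.
exact: mem_face_at.
Qed.

Lemma face_inhabited f : f \in faces L -> exists v, f = face_at (col f) v.
Proof.
move=> fL; have /imsetP[d _ E] := fL; exists d.1; apply: face_at_uniq => //.
by rewrite E; apply: imset_f; apply: mem_face.
Qed.

Lemma rev_darts d : d \in darts L -> rev_dart d \in darts L.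
Proof. by rewrite !inE adj_sym. Qed.

Lemma dart_vertices d :
  (d.1 \in face_vertices (face d)) && (d.2 \in face_vertices (face d)).
Proof.
apply/andP; split; apply/imsetP.
  by exists d; rewrite ?mem_face.
by exists (face_next L d); rewrite ?face_next_mem.
Qed.

(** The face of the third color at an endpoint avoids the edge. A face at an endpoint that has the
    color of one side is that side, by uniqueness, so it contains the edge. *)
Lemma edge_colorE d c : d \in darts L ->
  edge_has_color L col d c = (col (face d) != c) && (col (face (rev_dart d)) != c).
Proof.
move=> dL; have rdL := rev_darts dL; have cd := col_faces dL.
have [d1 d2] := andP (dart_vertices d).
have /= /andP[rd2 rd1] := dart_vertices (rev_dart d).
have fL d' : d' \in darts L -> face d' \in faces L by move=> ?; apply: imset_f.
apply/forall_inP/idP => [h|/andP[n1 n2] f fF].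
  have [c'' /andP[n1 n2]] := third_color (col (face d)) (col (face (rev_dart d))).
  have := h _ (face_at_faces c'' d.1); rewrite mem_face_at col_face_at /=.
  have -> : on_boundary d (face_at c'' d.1) = false.
    apply/negP => /orP[] /face_eq E.
      by rewrite E col_face_at eqxx in n1.
    by rewrite E col_face_at eqxx in n2.
  by move=> /eqP <-; rewrite n1.
apply/implyP => /andP[dv]; apply: contraNT => ncf.
have cf : col f = col (face d) \/ col f = col (face (rev_dart d)).
  have := color_cases (col f) cd n2; rewrite eq_sym => /(_ n1)[] E; [by left|by right|].
  by rewrite E eqxx in ncf.
have fE d' : d' \in darts L -> d.1 \in face_vertices (face d') ->
    d.2 \in face_vertices (face d') -> col f = col (face d') -> f = face d'.
  move=> d'L h1 h2 E; case/orP: dv => /(face_at_uniq fF) ->; rewrite E;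
    by rewrite -face_at_uniq ?fL.
rewrite /on_boundary; apply/orP.
by case: cf => E; [left|right]; rewrite (fE _ _ _ _ E) // mem_face.
Qed.

(** With w the chosen dart end, the face of color c at v borders the edges from v to w and to
    [turn v (turn v w)]; the remaining edge is the one of color c. *)
Definition neighbor c v : V := turn v (face_dart c v).

Lemma neighbor_adj c v : adj L v (neighbor c v).
Proof. by have [/turnP[]] := face_dartP c v. Qed.

Lemma neighbor_color c v : edge_has_color L col (v, neighbor c v) c.
Proof.
rewrite edge_colorE ?inE ?neighbor_adj // /rev_dart /= (face_rev v) /neighbor.
have := face_dartP c v; set w := face_dart c v => -[vw <-].
have [w3 vw' _] := turnP vw; have [_ vw'' _] := turnP vw'.
rewrite eq_sym col_turn //=.
by have := col_turn vw''; rewrite w3.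
Qed.

Lemma neighbor_uniq c v w :
  adj L v w -> edge_has_color L col (v, w) c -> w = neighbor c v.
Proof.
move=> vw; rewrite edge_colorE ?inE //= /rev_dart /= (face_rev v) => /andP[n1 n2].
have [w3 vw' _] := turnP vw; have [_ vw'' _] := turnP vw'.
rewrite /neighbor; case: (face_colors c vw) => E.
- by rewrite E eqxx in n1.
- by rewrite E eqxx in n2.
- by rewrite E face_dart_uniq.
Qed.

Lemma edge_color_rev c d : d \in darts L ->
  edge_has_color L col (rev_dart d) c = edge_has_color L col d c.
Proof. by case: d => v w dL; rewrite !edge_colorE ?rev_darts //= andbC. Qed.

Lemma neighborK c : involutive (neighbor c).
Proof.
move=> v; apply/esym/neighbor_uniq; first by rewrite adj_sym neighbor_adj.
rewrite -[(_, v)]/(rev_dart (v, neighbor c v)) edge_color_rev ?neighbor_color //.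
by rewrite inE neighbor_adj.
Qed.

Lemma neighbor_exists v w : adj L v w ->
  exists2 c, w = neighbor c v & col (face (v, w)) != c.
Proof.
move=> vw; have [c /andP[n1 n2]] := third_color (col (face (v, w))) (col (face (w, v))).
by exists c => //; apply: neighbor_uniq; rewrite // edge_colorE ?inE // n1.
Qed.

(** The two sides of an edge of color c carry the two other colors, and both sides pass through both
    ends. *)
Lemma face_at_neighbor c c' v : c' != c -> face_at c' (neighbor c v) = face_at c' v.
Proof.
move=> nc; set w := neighbor c v; have vw : adj L v w := neighbor_adj c v.
have dL : (v, w) \in darts L by rewrite inE.
have := neighbor_color c v; rewrite edge_colorE // => /andP[n1 n2].
have fE d : d \in darts L -> v \in face_vertices (face d) ->
    w \in face_vertices (face d) -> c' = col (face d) -> face_at c' w = face_at c' v.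
  by move=> dL' vd wd ->; rewrite -!face_at_uniq //; apply: imset_f.
have /andP[/= h1 h2] := dart_vertices (v, w).
have /andP[/= h3 h4] := dart_vertices (w, v).
have := color_cases c' (col_faces dL) n2; rewrite eq_sym => /(_ n1)[] E.
- exact: (fE (v, w)).
- exact: (fE (w, v) (rev_darts dL) h4 h3 E).
- by rewrite E eqxx in nc.
Qed.

Lemma connected_const (T : Type) (h : V -> T) :
  (forall c v, h (neighbor c v) = h v) -> forall v u, h v = h u.
Proof.
move=> hn v u; have /connectP[p + ->] := adj_connected L v u.
elim: p v => //= w p IHp v /andP[/neighbor_exists[c E _] /IHp <-].
by rewrite E hn.
Qed.

(** The boundary walk of a face of color c uses only edges of other colors. *)
Lemma face_const (T : Type) c (h : V -> T) :
  (forall c' v, c' != c -> h (neighbor c' v) = h v) ->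
  forall v u, face_at c v = face_at c u -> h v = h u.
Proof.
move=> hn v u E; have := mem_face_at c u; rewrite -E => /imsetP[d + ->].
rewrite inE => /iter_findex <-; elim: findex => //= n ->.
set d0 := iter n _ _.
have d0F : d0 \in face_at c v by rewrite inE fconnect_iter.
have [vw _] := face_dartP c v.
have d0L : d0 \in darts L by apply: (darts_face _ d0F); rewrite inE.
have cd0 : col (face d0) = c by rewrite (face_eq d0F) col_face_at.
move: d0L cd0; rewrite inE; case: d0 {d0F} => a b /= ab cab.
have [c' E' nc] := neighbor_exists ab.
by rewrite E' hn // -cab eq_sym.
Qed.

Lemma neighbor_circle c v : (neighbor c v \in circle) = (v \notin circle).
Proof.
have := L_bipartite (neighbor_adj c v).
by case: (v \in circle); case: (_ \in circle).
Qed.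

Lemma color_edgesE c d :
  (d \in color_edges L col circle c) = (d.1 \in circle) && (d.2 == neighbor c d.1).
Proof.
rewrite inE; case: d => v w /=; rewrite [(v, w) \in _]inE /=.
case: (v \in circle); rewrite /= ?andbF //.
apply/andP/eqP => [[vw /neighbor_uniq -> //]|->].
by rewrite neighbor_adj neighbor_color.
Qed.

Definition edge_at c v : V * V :=
  if v \in circle then (v, neighbor c v) else (neighbor c v, v).

Lemma edge_at_color_edges c v : edge_at c v \in color_edges L col circle c.
Proof.
rewrite color_edgesE /edge_at; case: ifP => /= [->|vN]; first by rewrite eqxx.
by rewrite neighbor_circle vN neighborK eqxx.
Qed.

Lemma edge_at_neighbor c v : edge_at c (neighbor c v) = edge_at c v.
Proof. by rewrite /edge_at neighbor_circle neighborK; case: (v \in circle). Qed.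

Lemma edge_at_uniq c d v : d \in color_edges L col circle c ->
  (v == d.1) || (v == d.2) = (d == edge_at c v).
Proof.
rewrite color_edgesE; case: d => a b /= /andP[ac /eqP->].
rewrite /edge_at; apply/orP/eqP => [[/eqP->|/eqP->]|].
- by rewrite ac.
- by rewrite neighbor_circle ac neighborK.
- by case: ifP => vc [-> _]; [left|right; rewrite neighborK].
Qed.

Lemma card_color_edges c : #|color_edges L col circle c| = #|circle|.
Proof.
rewrite -(card_in_imset (f := fun v => (v, neighbor c v)) (D := mem circle)); last first.
  by move=> v u _ _ [].
apply: eq_card => -[a b]; rewrite color_edgesE /=.
by apply/andP/imsetP => [[ac /eqP->]|[v vc [-> ->]]]; [exists a|rewrite vc].
Qed.

(** The green edges match circle vertices perfectly with square vertices. *)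
Lemma card_circle : #|V| = (2 * #|circle|)%N.
Proof.
rewrite -(cardsC circle) mul2n -addnn; congr (_ + _)%N.
rewrite -(card_imset (mem circle) (can_inj (neighborK Green))).
apply: eq_card => v; rewrite inE; apply/idP/imsetP => [vN|[u uc ->]].
  by exists (neighbor Green v); rewrite ?neighborK // neighbor_circle.
by rewrite neighbor_circle negbK.
Qed.

(** Each edge has exactly one circle end, and each circle vertex has degree 3. *)
Lemma card_edges : #|edges L| = (3 * #|circle|)%N.
Proof.
pose Cd := [set d in darts L | d.1 \in circle].
have -> : edges L = [set [set d.1; d.2] | d in Cd].
  apply/setP => x; apply/imsetP/imsetP => [[d dL ->]|[d]]; last first.
    by rewrite inE => /andP[dL _] ->; exists d.
  case dc : (d.1 \in circle); first by exists d => //; rewrite inE dL.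
  exists (rev_dart d); last by rewrite finset.setUC.
  rewrite inE rev_darts //=; move: dL; rewrite inE => /L_bipartite.
  by rewrite dc; case: (d.2 \in circle).
rewrite card_in_imset; last first.
  move=> [a b] [a' b']; rewrite !inE /= => /andP[ab ac] /andP[ab' ac'].
  have bN : b \notin circle by have := L_bipartite ab; rewrite ac; case: (b \in _).
  have bN' : b' \notin circle by have := L_bipartite ab'; rewrite ac'; case: (b' \in _).
  move=> /setP E; have := E a; have := E b; rewrite !inE !eqxx orbT /=.
  move=> /esym/orP[/eqP bb|/eqP->]; first by rewrite bb ac' in bN.
  by move=> /esym/orP[/eqP->//|/eqP aa]; rewrite aa (negPf bN') in ac.
rewrite -sum1_card (eq_bigl (fun d => (d.1 \in circle) && adj L d.1 d.2)); last first.
  by move=> d; rewrite !inE andbC.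
rewrite -(pair_big_dep (mem circle) (adj L) (fun _ _ => 1%N)) /=.
rewrite (eq_bigr (fun=> 3)) ?sum_nat_const ?(mulnC 3) // => v _.
by rewrite -(L_cubic v) -sum1_card; apply: eq_bigl => u; rewrite inE.
Qed.

(** With m circle vertices there are 2m vertices, 3m edges and m edges of color c, so Euler's
    formula reads [#|faces L|] - m = 2 - 2g. *)
Lemma euler_count g c : has_genus L g ->
  (#|color_edges L col circle c| + #|faces L| + 2 * g = #|V| + 2)%N.
Proof.
rewrite /has_genus card_color_edges card_edges card_circle => E.
by lia.
Qed.

End Combinatorics.

(** * Symplectic vectors of the check and plaquette Paulis *)

Section LocalPaulis.
Variables (R : realType) (D : nat).
Hypotheses (D_prime : prime D) (D_ge3 : (3 <= D)%N).
Local Notation F := 'F_D.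
Implicit Types (x y : F * F).

Definition weyl_multiple (A : 'M[R[i]]_D) x : Prop :=
  exists k : F, A = echar R k *: weyl1 R x.

Lemma weyl_multiple1 : weyl_multiple 1%:M 0.
Proof. by exists 0; rewrite weyl1_0 // echar0 // scale1r. Qed.

Lemma weyl_multipleM A B x y :
  weyl_multiple A x -> weyl_multiple B y -> weyl_multiple (A *m B) (x + y).
Proof.
move=> [k ->] [l ->]; exists (k + l + symp1 x y / 2).
by rewrite -scalemxAl -scalemxAr weyl1_mul // !scalerA !echarD.
Qed.

Lemma weyl_multipleV A x : weyl_multiple A x -> weyl_multiple (invmx A) (- x).
Proof.
move=> [k ->]; exists (- k).
have E : echar R k *: weyl1 R x *m (echar R (- k) *: weyl1 R (- x)) = 1%:M.
  rewrite -scalemxAl -scalemxAr weyl1_mul // !scalerA -!echarD //.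
  rewrite (subrr x) weyl1_0 // (_ : _ + _ = 0) ?echar0 ?scale1r //.
  by rewrite /symp1 /=; ring.
have [U _] := mulmx1_unit E.
by rewrite -[RHS](mulKmx U) E mulmx1.
Qed.

Lemma weyl_multipleX : weyl_multiple (pauliX R D) (1, 0).
Proof.
exists 0; rewrite echar0 // scale1r; apply/matrixP=> i j; rewrite !mxE /=.
rewrite mul0r mulr0 mul0r addr0 echar0 //; congr (nat_of_bool _)%:R.
(* The cyclic shift modulo D is addition of 1 in F_D. *)
apply/eqP/eqP => [|/(congr1 (@nat_of_ord _))].
  by rewrite /ordF => ->; rewrite natr1 (GRing.natr_mod_pchar (pchar_Fp D_prime)).
by rewrite /ordF natr1 !natF_mod // modn_small.
Qed.

Lemma weyl_multipleZ : weyl_multiple (pauliZ R D) (0, 1).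
Proof.
exists 0; rewrite echar0 // scale1r; apply/matrixP=> i j; rewrite !mxE /=.
rewrite !mul1r !mul0r !addr0 (inj_eq (ordF_inj D_prime)).
by rewrite /ordF echar_nat.
Qed.

(** The three vectors at a vertex sum to 0, and the plaquette Paulis have the opposite vectors.
    Passing from circle to square flips the sign of every symplectic product. *)
Definition check_vector (c : color) (on_circle : bool) : F * F :=
  match c with
  | Green => (- 2, 0)
  | Red => (1, if on_circle then 1 else - 1)
  | Blue => (1, if on_circle then - 1 else 1)
  end.

Lemma check_paulisE c :
  weyl_multiple (check_paulis R D c).1 (check_vector c true) /\
  weyl_multiple (check_paulis R D c).2 (check_vector c false).
Proof.
have X := weyl_multipleX; have Z := weyl_multipleZ; have Z' := weyl_multipleV Z.
case: c => /=; split.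
- have -> : (-2, 0) = - ((1, 0) + (1, 0)) :> F * F.
    by congr (_, _); rewrite /=; ring.
  exact/weyl_multipleV/weyl_multipleM.
- have -> : (-2, 0) = - ((1, 0) + (1, 0)) :> F * F.
    by congr (_, _); rewrite /=; ring.
  exact/weyl_multipleV/weyl_multipleM.
- have -> : (1, 1) = (1, 0) + (0, 1) :> F * F by congr (_, _); rewrite /=; ring.
  exact: weyl_multipleM.
- have -> : (1, -1) = (1, 0) - (0, 1) :> F * F by congr (_, _); rewrite /=; ring.
  exact: weyl_multipleM.
- have -> : (1, -1) = (1, 0) - (0, 1) :> F * F by congr (_, _); rewrite /=; ring.
  exact: weyl_multipleM.
- have -> : (1, 1) = (1, 0) + (0, 1) :> F * F by congr (_, _); rewrite /=; ring.
  exact: weyl_multipleM.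
Qed.

Lemma plaquette_paulisE c :
  weyl_multiple (plaquette_paulis R D c).1 (- check_vector c true) /\
  weyl_multiple (plaquette_paulis R D c).2 (- check_vector c false).
Proof.
have X := weyl_multipleX; have Z := weyl_multipleZ.
have X' := weyl_multipleV X; have Z' := weyl_multipleV Z.
case: c => /=; split.
- have -> : - (-2, 0) = (1, 0) + (1, 0) :> F * F by congr (_, _); rewrite /=; ring.
  exact: weyl_multipleM.
- have -> : - (-2, 0) = (1, 0) + (1, 0) :> F * F by congr (_, _); rewrite /=; ring.
  exact: weyl_multipleM.
- have -> : - (1, 1) = - (1, 0) - (0, 1) :> F * F by congr (_, _); rewrite /=; ring.
  exact: weyl_multipleM.
- have -> : - (1, -1) = - (1, 0) + (0, 1) :> F * F by congr (_, _); rewrite /=; ring.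
  exact: weyl_multipleM.
- have -> : - (1, -1) = - (1, 0) + (0, 1) :> F * F by congr (_, _); rewrite /=; ring.
  exact: weyl_multipleM.
- have -> : - (1, 1) = - (1, 0) - (0, 1) :> F * F by congr (_, _); rewrite /=; ring.
  exact: weyl_multipleM.
Qed.

Lemma tensor_weyl (V : finType) (A : V -> 'M[R[i]]_D) (x : {ffun V -> F * F}) :
  (forall v, weyl_multiple (A v) (x v)) -> exists k, tensor A = weyl R (x, k).
Proof.
move=> /fin_all_exists[k kE]; exists (\sum_v k v).
by rewrite (eq_tensor kE) tensor_scale prod_echar.
Qed.

End LocalPaulis.

(** * One measurement round in coordinates *)

Section Floquet.
Variables (R : realType) (D : nat) (V : finType) (L : embedded_graph V).
Variables (col : {set V * V} -> color) (circle : {set V}).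
Hypotheses (D_prime : prime D) (D_ge3 : (3 <= D)%N).
Hypothesis L_cubic : forall v, #|[set u | adj L v u]| = 3.
Hypothesis col_faces : face_coloring L col.
Hypothesis L_bipartite : bipartition L circle.
Local Notation F := 'F_D.
Local Notation C := R[i].
Local Notation W := {ffun V -> 'F_D * 'F_D}.
Local Notation weyl := (@weyl R D V).
Local Notation neighbor := (neighbor L col).
Local Notation face_at := (face_at L col).
Local Notation edge_at := (edge_at L col circle).
Local Notation color_edges := (color_edges L col circle).
Implicit Types (c : color) (v : V) (d : V * V) (f : {set V * V}) (x y : W).

Local Notation cvec c v := (check_vector D c (v \in circle)).

Definition edge_vector c d : W :=
  [ffun v => if (v == d.1) || (v == d.2) then cvec c v else 0].

Definition face_vector f : W :=
  [ffun v => if v \in face_vertices f then - cvec (col f) v else 0].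

Lemma check_weyl c d : d \in color_edges c ->
  exists k, check R D c d = weyl (edge_vector c d, k).
Proof.
rewrite color_edgesE // => /andP[d1 /eqP d2].
have d2N : d.2 \notin circle by rewrite d2 neighbor_circle // negbK.
have [h1 h2] := check_paulisE R D_prime D_ge3 c.
rewrite /check /at_vertex tensor_mul; apply: tensor_weyl => // v.
rewrite ffunE; have [->|nv1] := eqVneq v d.1.
  have -> : (d.1 == d.2) = false by apply/negP => /eqP E; rewrite -E d1 in d2N.
  by rewrite mulmx1 d1.
have [->|nv2] := eqVneq v d.2; first by rewrite mul1mx (negPf d2N).
by rewrite mulmx1; apply: weyl_multiple1.
Qed.

Lemma plaquette_weyl f : exists k, plaquette R D col circle f = weyl (face_vector f, k).
Proof.
have [h1 h2] := plaquette_paulisE R D_prime D_ge3 (col f).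
apply: tensor_weyl => // v; rewrite ffunE.
case: (v \in face_vertices f); last exact: weyl_multiple1.
by case: (v \in circle).
Qed.

Definition scale2 (a : F) (z : F * F) : F * F := (a * z.1, a * z.2).

Lemma mulrz_scale2 (z : F * F) (m : int) : z *~ m = scale2 m%:~R z.
Proof.
have h (n : nat) : z *+ n = scale2 n%:R z.
  elim: n => [|n IHn]; first by rewrite mulr0n /scale2 !mul0r.
  by rewrite mulrS IHn -natr1 /scale2; congr (_, _); rewrite /=; ring.
case: m => n; first exact: h.
by rewrite NegzE !mulrNz -!pmulrn h /scale2; congr (_, _); rewrite /= mulNr.
Qed.

Lemma ffun_mulrz x (m : int) v : (x *~ m) v = x v *~ m.
Proof.
have h (n : nat) : (x *+ n) v = x v *+ n.
  by elim: n => [|n IHn]; rewrite ?mulr0n ?ffunE // !mulrS ffunE IHn.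
by case: m => n; rewrite ?NegzE ?mulrNz ?ffunE -!pmulrn h.
Qed.

(* The general element, in coordinates, of the group generated by the checks
   of color c and the plaquettes. *)
Definition combination c (m : V * V -> F) (n : {set V * V} -> F) : W :=
  [ffun v => scale2 (m (edge_at c v)) (cvec c v)
    + (scale2 (n (face_at Green v)) (cvec Green v)
     + scale2 (n (face_at Red v)) (cvec Red v)
     + scale2 (n (face_at Blue v)) (cvec Blue v))].

(** Only one term survives, as v has exactly one edge of color c. *)
Lemma sum_edge_vectors c (m : V * V -> int) v :
  (\sum_(d in color_edges c) edge_vector c d *~ m d) v =
  scale2 (m (edge_at c v))%:~R (cvec c v).
Proof.
rewrite sum_ffunE (bigD1 (edge_at c v)) ?edge_at_color_edges //= big1 ?addr0.
  rewrite ffun_mulrz ffunE.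
  rewrite (edge_at_uniq L_cubic col_faces L_bipartite v
    (edge_at_color_edges L_cubic col_faces L_bipartite c v)) eqxx.
  exact: mulrz_scale2.
move=> d /andP[dc nd]; rewrite ffun_mulrz ffunE.
by rewrite (edge_at_uniq L_cubic col_faces L_bipartite v dc) (negPf nd) mul0rz.
Qed.

(** One face of each color passes through v; the signs appear because plaquettes carry the negated
    check vectors. *)
Lemma sum_face_vectors (n : {set V * V} -> int) v :
  (\sum_(f in faces L) face_vector f *~ n f) v =
  scale2 (- (n (face_at Green v))%:~R) (cvec Green v)
  + scale2 (- (n (face_at Red v))%:~R) (cvec Red v)
  + scale2 (- (n (face_at Blue v))%:~R) (cvec Blue v).
Proof.
have one c : \sum_(f in faces L | col f == c) (face_vector f *~ n f) v =
    scale2 (- (n (face_at c v))%:~R) (cvec c v).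
  rewrite (bigD1 (face_at c v)) ?face_at_faces ?col_face_at ?eqxx //= big1 ?addr0.
    rewrite ffun_mulrz ffunE mem_face_at // col_face_at // mulrz_scale2.
    by congr (_, _); rewrite /=; ring.
  move=> f /andP[/andP[fL /eqP fc] nf]; rewrite ffun_mulrz ffunE.
  by rewrite (face_at_vertices L_cubic col_faces v fL) fc (negPf nf) mul0rz.
rewrite sum_ffunE -!one (bigID (fun f => col f == Green)) /=.
rewrite [X in _ + X](bigID (fun f => col f == Red)) /= addrA.
by congr (_ + _ + _); apply: eq_bigl => f; case: (f \in _); case: (col f).
Qed.

Lemma symp_edge_vector c v x : v \in circle ->
  symp x (edge_vector c (v, neighbor c v)) =
  symp1 (x v) (cvec c v) + symp1 (x (neighbor c v)) (cvec c (neighbor c v)).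
Proof.
move=> vc; have nv : neighbor c v != v.
  apply/negP => /eqP E; have := neighbor_circle L_cubic col_faces L_bipartite c v.
  by rewrite E vc.
rewrite /symp (bigD1 v) //= (bigD1 (neighbor c v)) //= big1 ?addr0.
  by rewrite !ffunE /= !eqxx orbT.
move=> u /andP[nu1 nu2]; rewrite ffunE /= (negPf nu1) (negPf nu2).
by rewrite /symp1 !mulr0 subrr.
Qed.

Lemma symp_edge_vectors c d d' : symp (edge_vector c d) (edge_vector c d') = 0.
Proof.
rewrite /symp big1 // => v _; rewrite !ffunE /symp1.
by do 2 case: ifP => _; rewrite /= ?mul0r ?mulr0 ?subrr // mulrC subrr.
Qed.

(* The plaquettes and the checks of color c' drop out: the former have opposite
   commutation phases at the two ends of the edge. *)
Lemma symp_combination c c' m n v : v \in circle -> c != c' ->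
  symp (combination c m n) (edge_vector c' (v, neighbor c' v)) =
  (m (edge_at c v) - m (edge_at c (neighbor c' v))) *
    symp1 (check_vector D c true) (check_vector D c' true).
Proof.
move=> vc ncc; rewrite symp_edge_vector // !ffunE.
have fE c0 : c0 != c' -> face_at c0 (neighbor c' v) = face_at c0 v.
  by move=> ?; apply: face_at_neighbor.
rewrite neighbor_circle // vc /=.
by case: c c' ncc fE => [] [] // _ fE; do ?[rewrite (fE Green); last by []];
  do ?[rewrite (fE Red); last by []]; do ?[rewrite (fE Blue); last by []];
  rewrite /symp1 /=; ring.
Qed.

(** The value is 2 or -2, nonzero because D is odd. *)
Lemma symp1_check_vector c c' : c != c' ->
  symp1 (check_vector D c true) (check_vector D c' true) != 0.
Proof.
have h2 := two_neq0 D_prime D_ge3.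
have h2' : (- 2 : F) != 0 by rewrite oppr_eq0.
by case: c c' => [] [] //= _; rewrite /symp1 /=;
  first [ rewrite (_ : _ - _ = 2); [done | ring]
        | rewrite (_ : _ - _ = -2); [done | ring]].
Qed.

Lemma combinationE c m n v : combination c m n v =
  scale2 (m (edge_at c v)) (cvec c v)
    + (scale2 (n (face_at Green v)) (cvec Green v)
     + scale2 (n (face_at Red v)) (cvec Red v)
     + scale2 (n (face_at Blue v)) (cvec Blue v)).
Proof. by rewrite ffunE. Qed.

(* A choice of vertex turns a function of vertices that is constant on faces
   into a function of faces. *)
Definition face_vertex f : option V := [pick v in face_vertices f].

Lemma face_vertex_const (h : V -> F) c v :
  (forall c' u, c' != c -> h (neighbor c' u) = h u) ->
  oapp h 0 (face_vertex (face_at c v)) = h v.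
Proof.
move=> hn; rewrite /face_vertex; case: pickP => [u /= uf|]; last first.
  by move/(_ v); rewrite /= mem_face_at.
apply: (face_const L_cubic col_faces hn).
have := face_at_uniq L_cubic col_faces (face_at_faces L_cubic col_faces c v) uf.
by rewrite col_face_at.
Qed.

Definition next_color c := match c with Green => Red | Red => Blue | Blue => Green end.

Lemma edge_at_fst_face c c' v : c' != c -> face_at c' (edge_at c v).1 = face_at c' v.
Proof.
by move=> nc; rewrite /edge_at; case: ifP => //= _; apply: face_at_neighbor.
Qed.

Lemma edge_at_fst (h : V -> F) c v :
  (forall u, h (neighbor c u) = h u) -> h (edge_at c v).1 = h v.
Proof. by move=> hn; rewrite /edge_at; case: ifP => //= _. Qed.

Definition combinations c (A : pred color) x : Prop :=
  exists m n, (forall f, ~~ A (col f) -> n f = 0) /\ x = combination c m n.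

(** Converts exponents in F_D into the integer multiples under which additive subgroups are
    closed. *)
Lemma int_lift (I : Type) (m : I -> F) : exists m' : I -> int, forall i, (m' i)%:~R = m i.
Proof. by exists (fun i => (m i : nat)%:Z) => i; rewrite -pmulrn natF_val. Qed.

(** Commuting with the new checks forces the old exponents to be constant around faces of color c''.
    Since the local vectors of c, c', c'' sum to 0, old checks can then be traded for new checks and
    plaquettes of color c'', and conversely. *)
Lemma combination_round c A x :
  let c' := next_color c in let c'' := next_color c' in
  (exists (m : V * V -> int) y,
    [/\ combinations c A y,
        {in color_edges c', forall d, symp y (edge_vector c' d) = 0}
      & x = \sum_(d in color_edges c') edge_vector c' d *~ m d + y]) <->
  combinations c' (predU1 c'' A) x.
Proof.
move=> c' c''.
have [n1 n2 n3] : [/\ c != c', c' != c'' & c'' != c] by rewrite /c'' /c'; case: (c).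
split.
  move=> [k [_ [[m [n [nA ->]]] orth ->]]].
  have mn v : m (edge_at c (neighbor c' v)) = m (edge_at c v).
    (* Exchanging the ends of the edge exchanges the two sides of the equation. *)
    wlog vc : v / v \in circle.
      move=> hw; case vc : (v \in circle); first exact: hw.
      rewrite -{2}[v](neighborK L_cubic col_faces c') [RHS]hw //.
      by rewrite neighbor_circle // vc.
    have /orth : (v, neighbor c' v) \in color_edges c'.
      by rewrite color_edgesE //= vc eqxx.
    move/eqP; rewrite symp_combination // mulf_eq0.
    by rewrite (negPf (symp1_check_vector n1)) orbF subr_eq0 => /eqP.
  pose h v := m (edge_at c v).
  have hn c0 u : c0 != c'' -> h (neighbor c0 u) = h u.
    move=> nc; have [->|->|E] := color_cases c0 n1 n2 n3.
    - by rewrite /h edge_at_neighbor.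
    - exact: mn.
    - by rewrite E eqxx in nc.
  (* A coefficient h on the c-vector is the same as -h on both the c'-vector and the c''-vector. *)
  exists (fun d => (k d)%:~R - h d.1),
    (fun f => n f - (if col f == c'' then oapp h 0 (face_vertex f) else 0)).
  split=> [f|].
    by rewrite /= negb_or => /andP[/negPf-> /nA->]; rewrite subr0.
  apply/ffunP => v; rewrite ffunE sum_edge_vectors !combinationE.
  have hc'' := face_vertex_const v hn.
  rewrite (edge_at_fst (h := h)); last by move=> u; apply: hn.
  have hE c0 : (if c0 == c'' then oapp h 0 (face_vertex (face_at c0 v)) else 0) =
      if c0 == c'' then h v else 0 by case: eqP => // ->.
  rewrite -/(h v) !col_face_at // !{}hE /c'' /c'.
  by case: (c); case: (v \in circle); congr (_, _); rewrite /=; ring.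
move=> [m [n [nA ->]]]; have n2' : c'' != c' by rewrite eq_sym.
(* The reverse trade: the coefficient of each c''-face moves, with its sign changed, to the checks
   of colors c and c'. *)
have [k kE] := int_lift (fun d => m d - n (face_at c'' d.1)).
exists k, (combination c (fun d => - n (face_at c'' d.1))
  (fun f => if col f == c'' then 0 else n f)); split.
- exists (fun d => - n (face_at c'' d.1)), (fun f => if col f == c'' then 0 else n f).
  split=> // f fA; case: ifP => // fc; apply: nA.
  by rewrite /= negb_or fc.
- move=> [v w]; rewrite color_edgesE //= => /andP[vc /eqP->].
  rewrite symp_combination // !edge_at_fst_face // face_at_neighbor //.
  by rewrite subrr mul0r.
apply/ffunP => v; rewrite [RHS]ffunE sum_edge_vectors !combinationE kE.
rewrite !edge_at_fst_face // /= !col_face_at //.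
set s := n (face_at c'' v).
have sE c0 : (if c0 == c'' then 0 else n (face_at c0 v)) =
    n (face_at c0 v) - if c0 == c'' then s else 0.
  by case: eqP => [->|_]; rewrite ?subrr ?subr0.
rewrite !{}sE; move: s; rewrite /c'' /c' => s.
by case: (c); case: (v \in circle); congr (_, _); rewrite /=; ring.
Qed.

End Floquet.

(** * The instantaneous stabilizer groups and their size *)

Section FloquetCode.
Variables (R : realType) (D : nat) (V : finType) (L : embedded_graph V).
Variables (col : {set V * V} -> color) (circle : {set V}).
Hypotheses (D_prime : prime D) (D_ge3 : (3 <= D)%N).
Hypothesis L_cubic : forall v, #|[set u | adj L v u]| = 3.
Hypothesis col_faces : face_coloring L col.
Hypothesis L_bipartite : bipartition L circle.
Local Notation F := 'F_D.
Local Notation C := R[i].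
Local Notation W := {ffun V -> 'F_D * 'F_D}.
Local Notation weyl := (@weyl R D V).
Local Notation neighbor := (neighbor L col).
Local Notation face_at := (face_at L col).
Local Notation edge_at := (edge_at L col circle).
Local Notation color_edges := (color_edges L col circle).
Local Notation cvec c v := (check_vector D c (v \in circle)).
Local Notation edge_vector := (edge_vector D circle).
Local Notation face_vector := (face_vector D col circle).
Local Notation combination := (@combination D V L col circle).
Local Notation combinations := (@combinations D V L col circle).
Local Notation floquet_round := (@floquet_round R D V L col circle).
Implicit Types (c : color) (v : V) (d : V * V) (f : {set V * V}) (x y : W).
Implicit Types (K : {set W * F}).

Lemma check_phase c :
  exists k : V * V -> F, {in color_edges c, forall d,
    check R D c d = weyl (edge_vector c d, k d)}.
Proof.
have h d : exists k : F, d \in color_edges c -> check R D c d = weyl (edge_vector c d, k).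
  case dc : (d \in _); last by exists 0.
  by have [k kE] := check_weyl R D_prime D_ge3 L_cubic col_faces L_bipartite dc; exists k.
by have [k kE] := fin_all_exists h; exists k.
Qed.

Lemma stab_floquet_round c S S' K : stab S K -> floquet_round c S S' ->
  exists2 K', stab S' K' & forall x, support_space K' x <->
    exists (m : V * V -> int) y,
      [/\ support_space K y,
          {in color_edges c, forall d, symp y (edge_vector c d) = 0}
        & x = \sum_(d in color_edges c) edge_vector c d *~ m d + y].
Proof.
move=> SK [s sE]; have [k kE] := check_phase c.
have us : uniq s by rewrite (perm_uniq sE) enum_uniq.
have smem : s =i color_edges c by move=> d; rewrite (perm_mem sE) mem_enum.
rewrite (_ : [seq _ | d <- s] = [seq weyl (edge_vector c d, k d) | d <- s]); last first.
  by apply/eq_in_map => d; rewrite smem => /kE.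
case/(stab_measure_seq D_prime D_ge3 us _ SK) => [d d' _ _|K' SK' K'E].
  exact: symp_edge_vectors.
exists K' => // x; rewrite K'E.
have sumE (m : V * V -> int) : \sum_(d <- s) edge_vector c d *~ m d =
    \sum_(d in color_edges c) edge_vector c d *~ m d.
  by rewrite (perm_big _ sE) /= big_enum.
split=> -[m [y [yK ys ->]]]; exists m, y; split=> //; rewrite ?sumE //.
  by move=> d; rewrite -smem => /ys.
by move=> d; rewrite smem => /ys.
Qed.

Lemma combinations_start c x :
  (exists m : V * V -> int, x = \sum_(d in color_edges c) edge_vector c d *~ m d) <->
  combinations c pred0 x.
Proof.
split=> [[m ->]|[m [n [n0 ->]]]].
  exists (fun d => (m d)%:~R), (fun=> 0); split=> //; apply/ffunP => v.
  rewrite (sum_edge_vectors D L_cubic) // combinationE /scale2 !mul0r.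
  by rewrite !addr0.
have [m' m'E] := int_lift m; exists m'; apply/ffunP => v.
rewrite (sum_edge_vectors D L_cubic) // combinationE m'E !n0 // /scale2 !mul0r.
by rewrite !addr0.
Qed.

Lemma eq_combinations c A A' x :
  A =1 A' -> combinations c A x <-> combinations c A' x.
Proof.
by move=> AA'; split=> -[m [n [nA ->]]]; exists m, n; split=> // f fA;
  apply: nA; rewrite ?AA' // -AA'.
Qed.

Lemma round_colorS t : round_color t.+1 = next_color (round_color t).
Proof.
rewrite /round_color -addn1 -modnDml.
by have := ltn_pmod t (isT : (0 < 3)%N); case: (t %% 3)%N => [|[|[|]]].
Qed.

(* The colors whose plaquettes belong to the stabilizer group after round t. *)
Definition stabilized_color (t : nat) : pred color := fun c =>
  match c with Blue => (1 <= t)%N | Green => (2 <= t)%N | Red => (3 <= t)%N end.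

(** Rounds 1, 2, 3 measure red, blue, green and so add the blue, green, red plaquettes; afterwards
    all colors are present. *)
Lemma stabilized_colorS t :
  predU1 (next_color (round_color t.+1)) (stabilized_color t) =1 stabilized_color t.+1.
Proof.
case: t => [|[|[|t]]] []; rewrite //= ?orbT //.
Qed.

Lemma stab_floquet_run (S : nat -> set 'M[C]_(hdim D V)) : floquet_run L col circle S ->
  forall t, exists2 K, stab (S t) K &
    forall x, support_space K x <-> combinations (round_color t) (stabilized_color t) x.
Proof.
move=> [S0 SS]; elim=> [|t [K SK KE]].
  have [K SK KE] := stab_floquet_round (stab_start R V D_prime D_ge3) S0.
  exists K => // x; rewrite KE -(eq_combinations _ _ (A := pred0)); last by case.
  rewrite -combinations_start; split=> [[m [y [[k]]]]|[m ->]].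
    by rewrite inE => /eqP[-> _] _ ->; exists m; rewrite addr0.
  exists m, 0; rewrite addr0; split=> //; first by exists 0; rewrite inE.
  by move=> d _; rewrite symp0l.
have [K' SK' K'E] := stab_floquet_round SK (SS t).
exists K' => // x; rewrite K'E -(eq_combinations _ _ (@stabilized_colorS t)).
rewrite round_colorS -combination_round // -round_colorS.
by split=> -[m [y [/KE yK ys ->]]]; exists m, y.
Qed.


Lemma edge_vector_combination c d :
  d \in color_edges c -> combinations c predT (edge_vector c d).
Proof.
move=> dc; exists (fun d' => (d' == d)%:R), (fun=> 0); split=> //.
apply/ffunP => v; rewrite combinationE ffunE.
rewrite (edge_at_uniq L_cubic col_faces L_bipartite v dc) eq_sym.
by case: eqP => _; rewrite /scale2 !mul0r !addr0 // !mul1r -surjective_pairing.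
Qed.

Lemma face_vector_combination c f :
  f \in faces L -> combinations c predT (face_vector f).
Proof.
(* The sign compensates for the negated check vectors in [face_vector]. *)
move=> fL; exists (fun=> 0), (fun f' => - (f' == f)%:R); split=> //.
apply/ffunP => v; rewrite combinationE ffunE.
rewrite (face_at_vertices L_cubic col_faces v fL) eq_sym.
have E c0 : (face_at c0 v == f) = (c0 == col f) && (face_at (col f) v == f).
  have [->//|nc] := eqVneq c0 (col f); apply/negP => /eqP fE.
  by rewrite -fE col_face_at // eqxx in nc.
rewrite (E Green) (E Red) (E Blue) /scale2.
by case: (col f); case: (_ == f); case: (v \in circle); congr (_, _); rewrite /=; ring.
Qed.

Lemma combination_sum c m n : exists (k : V * V -> int) (l : {set V * V} -> int),
  combination c m n = \sum_(d in color_edges c) edge_vector c d *~ k d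
    + \sum_(f in faces L) face_vector f *~ l f.
Proof.
have [k kE] := int_lift m; have [l lE] := int_lift (fun f => - n f).
exists k, l; apply/ffunP => v; rewrite [RHS]ffunE combinationE.
rewrite (sum_edge_vectors D L_cubic) // (sum_face_vectors D circle L_cubic) //.
by rewrite !lE !opprK kE.
Qed.

Lemma zmod_closed_sum (U : zmodType) (H : {pred U}) (I : finType) (A : {pred I})
    (g : I -> U) :
  zmod_closed H -> {in A, forall i, g i \in H} -> \sum_(i in A) g i \in H.
Proof.
move=> Hz gH; have [H0 HD] := GRing.zmod_closedD Hz.
by elim/big_rec: _ => // i a iA aH; apply: HD => //; apply: gH.
Qed.

Lemma omega_powers (k : F) : exists o : 'I_D, omega R D ^+ o = echar R k.
Proof.
case: (ordF_bij D_prime) => g gK Kg; exists (g k).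
by rewrite -[in RHS](Kg k) /ordF echar_nat.
Qed.

(** The exponents a and b give each generator the phase with which its vector occurs in K. These
    generators suffice because an element of K is determined by its vector. *)
Lemma stab_generated (S : set 'M[C]_(hdim D V)) K t :
  stab S K -> (forall x, support_space K x <-> combinations (round_color t) predT x) ->
  exists (a : V * V -> 'I_D) (b : {set V * V} -> 'I_D),
    S = generated (round_generators L col circle t a b).
Proof.
set c := round_color t => SK KE.
have [Kz Kiso SE _] := SK.
have [k0 k0E] := check_phase c.
have [ka kaK] : exists ka : V * V -> F,
    {in color_edges c, forall d, (edge_vector c d, ka d) \in K}.
  have h d : exists k : F, d \in color_edges c -> (edge_vector c d, k) \in K.
    case dc : (d \in _); last by exists 0.
    by have /KE[k kK] := edge_vector_combination dc; exists k.
  by have [k kE] := fin_all_exists h; exists k.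
have [l0 l0E] : exists l : {set V * V} -> F,
    forall f, plaquette R D col circle f = weyl (face_vector f, l f).
  exact: fin_all_exists (plaquette_weyl R col circle D_prime D_ge3).
have [kb kbK] : exists kb : {set V * V} -> F,
    {in faces L, forall f, (face_vector f, kb f) \in K}.
  have h f : exists k : F, f \in faces L -> (face_vector f, k) \in K.
    case fL : (f \in _); last by exists 0.
    by have /KE[k kK] := face_vector_combination c fL; exists k.
  by have [k kE] := fin_all_exists h; exists k.
(* [k0] and [l0] are the phases of the given matrices, [ka] and [kb] the phases required by K. *)
have [a aE] := fin_all_exists (fun d => omega_powers (ka d - k0 d)).
have [b bE] := fin_all_exists (fun f => omega_powers (kb f - l0 f)).
have checkE d : d \in color_edges c ->
    omega R D ^+ a d *: check R D c d = weyl (edge_vector c d, ka d).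
  by move=> dc; rewrite k0E // aE weyl_scale //= addrC subrK.
have plaqE f :
    omega R D ^+ b f *: plaquette R D col circle f = weyl (face_vector f, kb f).
  by rewrite l0E bE weyl_scale //= addrC subrK.
exists a, b.
pose G := [set (edge_vector c d, ka d) | d in color_edges c]
  :|: [set (face_vector f, kb f) | f in faces L].
have GK : G \subset K.
  apply/fintype.subsetP => u; rewrite inE => /orP[]/imsetP[z zP ->]; first exact: kaK.
  exact: kbK.
have -> : round_generators L col circle t a b = @weyl_set R D V G.
  apply/seteqP; split.
    move=> _ [[d /= dc <-]|[f /= fL <-]].
      rewrite checkE //; exists (edge_vector c d, ka d) => //=.
      by rewrite inE imset_f.
    rewrite plaqE; exists (face_vector f, kb f) => //=.
    by rewrite inE imset_f ?orbT.
  move=> _ [u /= + <-]; rewrite inE => /orP[]/imsetP[z zP ->].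
    by left; exists z => //; apply: checkE.
  by right; exists z => //; apply: plaqE.
rewrite (generated_weyl_set R D_prime D_ge3 Kz Kiso GK) // => H Hz /fintype.subsetP GH.
apply/fintype.subsetP => -[x k] xK.
have /KE[m [n [_ xE]]] : support_space K x by exists k.
have [k' [l' E]] := combination_sum c m n.
(* z is built from the generators and has vector x, so injectivity identifies it with (x, k). *)
pose z := \sum_(d in color_edges c) (edge_vector c d, ka d) *~ k' d
  + \sum_(f in faces L) (face_vector f, kb f) *~ l' f.
have zH (H' : {set W * F}) : zmod_closed H' -> {subset G <= H'} -> z \in H'.
  move=> H'z GH'; apply: (GRing.zmod_closedD H'z).2; apply: zmod_closed_sum => // i iP;
    apply: zmod_closedMz => //; apply: GH'; rewrite inE imset_f ?orbT //.
suff -> : (x, k) = z by apply: zH.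
apply: (stab_inj D_prime D_ge3 SK) => //; first by apply: zH => //; apply/fintype.subsetP.
have fstD : {morph (fun u : W * F => u.1) : u v / u + v} by [].
rewrite /= xE E !(big_morph (fun u : W * F => u.1) fstD erefl).
by congr (_ + _); apply: eq_bigr => i _; rewrite fst_mulrz.
Qed.


(* Green + Red + Blue = 0 is the only linear relation between the local Paulis
   at a vertex. *)
Lemma check_vector_relation c b (a : F) (nu : color -> F) :
  scale2 a (check_vector D c b)
    + (scale2 (nu Green) (check_vector D Green b)
     + scale2 (nu Red) (check_vector D Red b)
     + scale2 (nu Blue) (check_vector D Blue b)) = 0 ->
  nu (next_color c) = nu (next_color (next_color c)) /\
  a + nu c = nu (next_color c).
Proof.
pose mu c0 := nu c0 + (if c0 == c then a else 0).
have -> : scale2 a (check_vector D c b)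
    + (scale2 (nu Green) (check_vector D Green b)
     + scale2 (nu Red) (check_vector D Red b)
     + scale2 (nu Blue) (check_vector D Blue b)) =
    scale2 (mu Green) (check_vector D Green b)
     + scale2 (mu Red) (check_vector D Red b)
     + scale2 (mu Blue) (check_vector D Blue b).
  by rewrite /mu; case: c @mu; case: b; congr (_, _); rewrite /=; ring.
move=> E; have E1 : _ = 0 := congr1 fst E; have E2 : _ = 0 := congr1 snd E.
have h2 := two_neq0 D_prime D_ge3.
have rb : mu Red = mu Blue.
  apply/eqP; rewrite -subr_eq0; apply/eqP; case: b E2 {E E1} => /= E2;
    last apply: oppr_inj; by rewrite ?oppr0 -[RHS]E2; ring.
have gb : mu Green = mu Blue.
  apply: (mulfI h2); apply/eqP; rewrite -subr_eq0; apply/eqP.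
  by rewrite -[RHS]oppr0 -[in RHS]E1 /= rb; ring.
rewrite addrC; have -> : nu c + a = mu c by rewrite /mu eqxx.
have muN c0 : c0 != c -> nu c0 = mu c0 by rewrite /mu => /negPf->; rewrite addr0.
by case: c @mu muN rb gb {E E1 E2} => mu muN rb gb; rewrite /= !muN // rb gb.
Qed.

(** [Phi] maps the exponents additively onto the vectors of K, and its kernel is a copy of F_D x
    F_D. *)
Lemma card_combinations c K :
  {in K &, injective fst} -> (forall x, support_space K x <-> combinations c predT x) ->
  (#|K| * D ^ 2 = D ^ (#|color_edges c| + #|faces L|))%N.
Proof.
move=> Kinj KE.
pose edgeT : finType := {d | d \in color_edges c}.
pose faceT : finType := {f | f \in faces L}.
pose ev v : edgeT :=
  exist (fun d => d \in color_edges c) _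
    (edge_at_color_edges L_cubic col_faces L_bipartite c v).
pose fv c0 v : faceT :=
  exist (fun f => f \in faces L) _ (face_at_faces L_cubic col_faces c0 v).
pose T : zmodType := ({ffun edgeT -> F} * {ffun faceT -> F})%type.
pose Phi (p : T) : W := [ffun v => scale2 (p.1 (ev v)) (cvec c v)
  + (scale2 (p.2 (fv Green v)) (cvec Green v)
   + scale2 (p.2 (fv Red v)) (cvec Red v)
   + scale2 (p.2 (fv Blue v)) (cvec Blue v))].
have PhiB p q : Phi (p - q) = Phi p - Phi q.
  apply/ffunP => v; rewrite !ffunE /= ?ffunE.
  by congr (_, _); rewrite /=; ring.
(* These exponents put the same coefficient s.1 on all three local vectors at every vertex, since
   (s.1 - s.2) + s.2 = s.1 for color c. *)
pose ker (s : F * F) : T :=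
  ([ffun=> s.1 - s.2], [ffun f => if col (val f) == c then s.2 else s.1]).
have Phi_ker s : Phi (ker s) = 0.
  apply/ffunP => v; rewrite !ffunE /= !col_face_at //.
  by case: (c); case: (v \in circle); congr (_, _); rewrite /=; ring.
have [v0 _] : exists v0 : V, true by have /card_gt0P[v0] := adj_nonempty L; exists v0.
have nc : next_color c != c by case: (c).
have ker_inj : injective ker.
  move=> [s s'] [r r'] [_ /ffunP E].
  have := E (fv c v0); have := E (fv (next_color c) v0).
  by rewrite !ffunE /= !col_face_at // eqxx (negPf nc) => -> ->.
have kerP p : Phi p = 0 -> exists s, p = ker s.
  move=> /ffunP p0.
  pose h c0 v := p.2 (fv c0 v).
  have rel v : h (next_color c) v = h (next_color (next_color c)) v /\
      p.1 (ev v) + h c v = h (next_color c) v.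
    apply: (check_vector_relation (b := v \in circle) (nu := h^~ v)).
    by move: (p0 v); rewrite !ffunE.
  have hn c0 c1 v : c0 != c1 -> h c0 (neighbor c1 v) = h c0 v.
    by move=> n01; congr (p.2 _); apply: val_inj; apply: face_at_neighbor.
  have en v : p.1 (ev (neighbor c v)) = p.1 (ev v).
    by congr (p.1 _); apply: val_inj; apply: edge_at_neighbor.
  (* Only edges of the face's own color change the face; there the equality with the exponent of the
     third color helps. Connectedness then makes the exponent globally constant. *)
  have h1n c1 v : h (next_color c) (neighbor c1 v) = h (next_color c) v.
    have [<-|n1] := eqVneq (next_color c) c1; last exact: hn.
    by rewrite !(rel _).1 hn //; case: (c).
  have hcn c1 v : h c (neighbor c1 v) = h c v.
    have [<-|n1] := eqVneq c c1; last exact: hn.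
    by apply: (addrI (p.1 (ev v))); rewrite -{1}en !(rel _).2 h1n.
  have h1 := connected_const L_cubic col_faces h1n _ v0.
  have hc := connected_const L_cubic col_faces hcn _ v0.
  exists (h (next_color c) v0, h c v0).
  rewrite [p]surjective_pairing; congr (_, _); apply/ffunP => -[z zP]; rewrite ffunE /=.
    have -> : exist _ z zP = ev z.1 :> edgeT.
      apply: val_inj; apply/eqP => /=.
      by rewrite -(edge_at_uniq L_cubic col_faces L_bipartite z.1 zP) eqxx.
    by rewrite -(h1 z.1) -(hc z.1) -(rel z.1).2 addrK.
  have [v zE] := face_inhabited L_cubic col_faces zP.
  have -> : exist _ z zP = fv (col z) v :> faceT by apply: val_inj.
  rewrite -/(h (col z) v); case: eqP => [->|/eqP nz]; first exact: hc.
  have [->|->] : col z = next_color c \/ col z = next_color (next_color c).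
    by case: (c) (col z) nz => [] []; auto.
  - exact: h1.
  - by rewrite -(rel v).1.
pose KT : finType := {u | u \in K}.
have sec (u : KT) : exists p, Phi p = (val u).1.
  case: u => -[x k] /= xK; have /KE[m [n [_ ->]]] : support_space K x by exists k.
  exists ([ffun e => m (val e)], [ffun f => n (val f)]).
  by apply/ffunP => v; rewrite !ffunE.
have [sigma sigmaE] := fin_all_exists sec.
(* A chosen preimage plus a kernel element reaches every exponent assignment exactly once. *)
pose psi (us : KT * (F * F)) : T := sigma us.1 + ker us.2.
have PhiD p q : Phi (p + q) = Phi p + Phi q.
  apply/ffunP => v; rewrite !ffunE /= ?ffunE.
  by congr (_, _); rewrite /=; ring.
have psi_inj : injective psi.
  move=> [u s] [u' s'] E; have := congr1 Phi E.
  rewrite !PhiD !Phi_ker !addr0 !sigmaE /= => /Kinj Eu.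
  have {Eu} uu : u = u' by apply: val_inj; apply: Eu; apply: valP.
  by move: E; rewrite /psi uu /= => /addrI/ker_inj->.
have psi_surj p : exists us, psi us = p.
  have : support_space K (Phi p).
    (* The default 0 is never read: [combination] evaluates only at edges of color c and at
       faces. *)
    apply/KE; exists (fun d => oapp p.1 0 (insub d)), (fun f => oapp p.2 0 (insub f)).
    split=> //; apply/ffunP => v; rewrite !ffunE.
    by rewrite (valK (ev v)) !(valK (fv _ v)).
  case=> k pK; pose u : KT := exist (fun u => u \in K) _ pK.
  have [s sE] : exists s, p - sigma u = ker s.
    by apply: kerP; rewrite PhiB sigmaE subrr.
  by exists (u, s); rewrite /psi /= -sE addrC subrK.
have /fin_all_exists[g gK] := psi_surj.
have /bij_eq_card : bijective psi.
  by exists g => // us; apply: psi_inj; rewrite gK.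
rewrite !card_prod !card_ffun !card_sig card_FD // expnD mulnn => <-.
by congr (_ * _)%N; apply: eq_card.
Qed.

End FloquetCode.

Theorem mainTheorem4 (R : realType) (D g p : nat) (V : finType)
    (L : embedded_graph V) (col : {set V * V} -> color) (circle : {set V})
    (D_prime : prime D) (D_ge3 : (3 <= D)%N)
    (g_ge1 : (1 <= g)%N)
    (p_torus : g = 1%N -> p = 6%N)
    (p_higher : (2 <= g)%N -> (8 <= p)%N /\ ~~ odd p)
    (L_lattice : is_lattice L p 3)
    (L_genus : has_genus L g)
    (col_faces : face_coloring L col)
    (L_bipartite : bipartition L circle) :
  exists T : nat,
    forall S : nat -> set 'M[R[i]]_(hdim D V),
      floquet_run L col circle S ->
      forall t : nat, (T <= t)%N ->
        has_dim (code_space (S t)) (D ^ (2 * g))%N /\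
        exists (a : V * V -> 'I_D) (b : {set V * V} -> 'I_D),
          S t = generated (round_generators L col circle t a b).
Proof.
have L_cubic := L_lattice.2.
(* From round 3 on the plaquettes of all three colors are stabilizers. *)
exists 3%N => S runS t t3.
have [K SK] := stab_floquet_run D_prime D_ge3 L_cubic col_faces L_bipartite runS t.
move=> KE0; have KE x : support_space K x <->
    combinations L col circle (round_color t) predT x.
  rewrite KE0; apply: eq_combinations => c.
  by case: c; rewrite /= ?t3 ?(ltnW t3) ?(ltnW (ltnW t3)).
split; last exact: stab_generated SK KE.
apply: (stab_has_dim D_prime D_ge3 SK).
have D_gt0 := prime_gt0 D_prime.
(* The factor D^2 accounts for the two relations, after which Euler's formula compares the
   exponents. *)
apply/eqP; rewrite -(eqn_pmul2r (m := (D ^ 2)%N)) ?expn_gt0 ?D_gt0 // mulnAC.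
rewrite (card_combinations D_prime D_ge3 L_cubic col_faces L_bipartite
  (stab_inj D_prime D_ge3 SK) KE).
by rewrite -!expnD (euler_count L_cubic col_faces L_bipartite _ L_genus).
Qed.
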